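(* Let $1\le p<2$ and let $X=\left(\oplus_{k\ge1}\left(\oplus_{m\ge1}X_{k,m}\right)_{\ell_p}\right)_{\ell_p}$ be the complex Banach space, isometric to a subspace of complex $L_p$, constructed in the context. Regard $X$ as a real Banach space. Then the equivalence relation $E_1$ is Borel reducible to linear isomorphism between complex structures on $X$, i.e. to $(\mathcal C(X),\simeq)$.
   Context: Complex structures. For a separable real Banach space $X$, $\mathcal B(X)$ (bounded real-linear operators) is a standard Borel space for the Borel structure generated by the strong operator topology, and $\mathcal C(X)=\{T\in\mathcal B(X): T^2=-\mathrm{Id}\}$ is a Borel subset, called the standard Borel space of complex structures on $X$. For $J,K\in\mathcal C(X)$, $J\simeq K$ iff there is an automorphism (bounded, boundedly invertible, real-linear) $A$ of $X$ with $AJA^{-1}=K$; equivalently the complex Banach spaces induced on $X$ by $J$ and $K$ are $\mathbb C$-linearly isomorphic. Reducibility. An equivalence relation $R$ on a standard Borel space $E$ is Borel reducible to $S$ on a standard Borel space $F$ if there is a Borel map $f:E\to F$ with $xRy\Leftrightarrow f(x)Sf(y)$ for all $x,y\in E$. $E_1$ is the relation of eventual agreement of sequences of reals: on $\mathbb R^{\mathbb N}$ (equivalently, up to Borel bireducibility, on $(2^\omega)^\omega$), $xE_1y$ iff there is $n$ with $x_m=y_m$ for all $m\ge n$. Construction of $X$. All spaces are over $\mathbb C$. Order the pairs $(k,m)$, $k,m\ge1$, as $(1,1),(1,2),(2,1),(1,3),(2,2),(3,1),\dots,(1,i),(2,i-1),\dots,(i,1),\dots$. Choose real numbers $q(k,m)\in(p,2]$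 such that for each fixed $k$, $q(k,m)$ decreases strictly to $p$ as $m\to\infty$, and $q(k,m+1)>q(k+1,m)>q(1,m+k+1)$ for all $k,m\ge1$ (so $q$ is strictly decreasing along the order $(1,1),(1,2),(2,1),(1,3),(2,2),(3,1),\dots,(1,i),(2,i-1),\dots,(i,1),\dots$ of the pairs $(k,m)$). For each $(k,m)$, with immediate successor $(k_0,m_0)$ in this order, choose $p_1(k,m)>p_2(k,m)>\dots>p_5(k,m)$ such that $$q(k,m)>p_1(k,m)>\dots>p_5(k,m)>q(k_0,m_0),$$ $$\tfrac1{p_2(k,m)}-\tfrac1{p_1(k,m)}=\tfrac1{p_3(k,m)}-\tfrac1{p_2(k,m)}=\tfrac1{p_4(k,m)}-\tfrac1{p_3(k,m)}=\tfrac1{p_5(k,m)}-\tfrac1{p_4(k,m)}=:\eta(k,m),$$ $$\frac{(m+k-1)(m+k)}2\,\eta(k,m)<\frac1{p_1(k,m)}-\frac1{q(k,m)}.$$ Put $N(k,m)=\left[(k+1)^{1/\eta(k,m)}\right]$ (integer part), so that $k<N(k,m)^{\eta(k,m)}\le k+1$. For fixed $(k,m)$ write $p_j=p_j(k,m)$, $\eta=\eta(k,m)$, $N=N(k,m)$, and $\gamma_1=N^{-2\eta}$, $\gamma_2=N^{-8\eta}$, $\gamma_3=N^{-24\eta}$. Let $(f_{j,t})_{t\ge1}$ be the unit vector basis of $\ell_{p_j}$, $j=1,\dots,5$, and in the $\ell_p$-direct sum $\ell_{p_1}\oplus_p\dots\oplus_p\ell_{p_5}$ put, for $t\ge1$,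 $$x_t=f_{1,t}+\gamma_1f_{3,t}+\gamma_2f_{4,t}+\gamma_3f_{5,t},\qquad y_t=f_{2,t}+\gamma_2f_{4,t}+i\gamma_3f_{5,t}.$$ Then $X_{k,m}$ is the closed linear span of $\{x_t,y_t:t\ge1\}$ in $\ell_{p_1}\oplus_p\dots\oplus_p\ell_{p_5}$. *)

(* Defs.v *)
From HB Require Import structures.
From mathcomp Require Import all_boot all_order all_algebra.
From mathcomp Require Import all_classical all_reals all_analysis.
From mathcomp Require Import ring complex.

Set Implicit Arguments.
Unset Strict Implicit.
Unset Printing Implicit Defensive.

Import Order.TTheory GRing.Theory Num.Theory.
Import numFieldNormedType.Exports.

Local Open Scope classical_set_scope.
Local Open Scope ring_scope.

(** * Borel structures and Borel reducibility *)

Definition borel (T : ptopologicalType) := g_sigma_algebraType (@open T).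

HB.instance Definition _ (T : ptopologicalType) := Measurable.on (borel T).

HB.instance Definition _ (I : Type) (T : I -> ptopologicalType) :=
  isPointed.Build (prod_topology T) (fun=> point).

(* E is an equivalence relation on the subset D of T and F one on the subset *)
(* D' of U; subsets carry the trace sigma-algebra.                           *)
Definition Borel_reducible d d' (T : measurableType d) (U : measurableType d')
    (D : set T) (E : T -> T -> Prop) (D' : set U) (F : U -> U -> Prop) :=
  exists f : T -> U, [/\ measurable_fun D f,
    forall x, D x -> D' (f x) &
    forall x y, D x -> D y -> (E x y <-> F (f x) (f y))].

Definition E1 (A : Type) (x y : nat -> A) :=
  exists n, forall m, (n <= m)%N -> x m = y m.

(** * Bounded operators and complex structures on a real Banach space *)

Record bounded_operator (R : realType) (V W : normedModType R) :=
  BoundedOperator {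
    bop_linear :> {linear V -> W};
    bop_bounded : bounded_near bop_linear (nbhs (0 : V)) }.

Section bounded_operator_instances.
Context {R : realType} {V W : normedModType R}.

Fact bop0_bounded : bounded_near (\0 : {linear V -> W}) (nbhs (0 : V)).
Proof. by apply/bounded_funP => r; exists 0 => x _; rewrite normr0. Qed.

HB.instance Definition _ := gen_eqMixin (bounded_operator V W).
HB.instance Definition _ := gen_choiceMixin (bounded_operator V W).
HB.instance Definition _ :=
  isPointed.Build (bounded_operator V W) (BoundedOperator bop0_bounded).

(* The strong operator topology: the topology of pointwise norm convergence.  *)
HB.instance Definition _ :=
  Topological.copy (bounded_operator V W)
    (initial_topology
       (fun T : bounded_operator V W => (T : V -> W) : {ptws V -> W})).

End bounded_operator_instances.

Section complex_structures.
Context {R : realType} {V : normedModType R}.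

Definition complex_structure : set (borel (bounded_operator V V)) :=
  [set J : bounded_operator V V | forall x, J (J x) = - x].

Definition complex_structure_iso (J K : bounded_operator V V) :=
  exists A B : bounded_operator V V,
    [/\ cancel A B, cancel B A & forall x, A (J (B x)) = K x].

End complex_structures.
Arguments complex_structure {R} V.
Arguments complex_structure_iso {R} V.

(** * The real normed space underlying a complex normed space *)

Definition rnorm (R : realType) (V : normedZmodType R[i]) (x : V) : R :=
  complex.Re `|x|.

Section rnorm_theory.
Context {R : realType} {V : normedZmodType R[i]}.
Implicit Types x y : V.

Lemma rnormE x : `|x| = (rnorm x)%:C%C.
Proof. by rewrite RRe_real ?normr_real. Qed.

Lemma rnorm_ge0 x : 0 <= rnorm x.
Proof. by rewrite -lecR -rnormE normr_ge0. Qed.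

Lemma rnorm0 : rnorm (0 : V) = 0.
Proof. by apply: complexI; rewrite -rnormE normr0. Qed.

Lemma rnorm_eq0 x : rnorm x = 0 -> x = 0.
Proof. by move=> x0; apply/normr0_eq0; rewrite rnormE x0. Qed.

Lemma ler_rnormD x y : rnorm (x + y) <= rnorm x + rnorm y.
Proof. by rewrite -lecR rmorphD/= -!rnormE ler_normD. Qed.

End rnorm_theory.

Lemma rnormC (R : realType) (a : R) : rnorm (a%:C%C : R[i]) = `|a|.
Proof. by rewrite /rnorm normc_def/= expr0n/= addr0 sqrtr_sqr. Qed.

Lemma rnormV (R : realType) (a : R[i]) : rnorm a^-1 = (rnorm a)^-1.
Proof. by apply: complexI; rewrite fmorphV/= -!rnormE normfV. Qed.

Lemma rnormZ (R : realType) (V : normedModType R[i]) (a : R[i]) (x : V) :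
  rnorm (a *: x) = rnorm a * rnorm x.
Proof. by apply: complexI; rewrite rmorphM/= -!rnormE normrZ. Qed.

Definition realification (R : realType) (V : normedModType R[i]) : Type := V.

Section realification_instances.
Context {R : realType} {V : normedModType R[i]}.

HB.instance Definition _ := GRing.Zmodule.on (realification V).

Let scale (a : R) (x : realification V) : realification V :=
  (a%:C%C : R[i]) *: (x : V).

Let scaleA a b x : scale a (scale b x) = scale (a * b) x.
Proof. by rewrite /scale scalerA rmorphM. Qed.

Let scale1 : left_id 1 scale.
Proof. by move=> x; rewrite /scale scale1r. Qed.

Let scaleDr : right_distributive scale +%R.
Proof. by move=> a x y; rewrite /scale scalerDr. Qed.

Let scaleDl x : {morph scale^~ x : a b / a + b}.
Proof. by move=> a b; rewrite /scale rmorphD scalerDl. Qed.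

HB.instance Definition _ := GRing.Zmodule_isLmodule.Build R (realification V)
  scaleA scale1 scaleDr scaleDl.

Let norm (x : realification V) : R := @rnorm R V x.

Let ler_normD (x y : realification V) : norm (x + y) <= norm x + norm y.
Proof. exact: ler_rnormD. Qed.

Let normrZ (a : R) (x : realification V) : norm (a *: x) = `|a| * norm x.
Proof.
by rewrite /norm {1}/GRing.scale/= /scale rnormZ rnormC.
Qed.

Let normr0_eq0 (x : realification V) : norm x = 0 -> x = 0.
Proof. exact: rnorm_eq0. Qed.

HB.instance Definition _ := Lmodule_isNormed.Build R (realification V)
  ler_normD normrZ normr0_eq0.

Lemma realification_normE (x : realification V) : `|x| = rnorm (x : V).
Proof. by []. Qed.

Lemma realification_scaleE (a : R) (x : realification V) :
  a *: x = (a%:C%C : R[i]) *: (x : V).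
Proof. by []. Qed.

End realification_instances.

(** * l_p-direct sums of complex normed spaces *)

Record exponent (R : realType) := Exponent {
  exponent_val :> R;
  exponent_ge1 : 1 <= exponent_val }.

Section lp_sum.
Context {R : realType} (p : exponent R) {I : choiceType}
  (V : I -> normedModType R[i]).

Definition lp_mass (f : forall i, V i) : \bar R :=
  \esum_(i in [set: I]) (rnorm (f i) `^ p)%:E.

Record lp_sum := LpSum {
  lp_coord :> forall i, V i;
  lp_finite : (lp_mass lp_coord < +oo)%E }.

HB.instance Definition _ := gen_eqMixin lp_sum.
HB.instance Definition _ := gen_choiceMixin lp_sum.

Implicit Types f g : forall i, V i.

Lemma lp_sumP (f g : lp_sum) : (forall i, f i = g i) -> f = g.
Proof.
case: f g => [f f1] [g g1] /= fg; have {}fg : f = g by exact: functional_extensionality_dep.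
by case: _ / fg f1 g1 => f1 g1; congr LpSum; exact: Prop_irrelevance.
Qed.

Let p0 : 0 < (p : R). Proof. exact: lt_le_trans (exponent_ge1 p). Qed.

Lemma lp_mass_ge0 f : (0 <= lp_mass f)%E.
Proof. by apply: esum_ge0 => i _; rewrite lee_fin powR_ge0. Qed.

Lemma lp_mass0 : lp_mass (fun=> 0) = 0.
Proof. by apply: esum1 => i _; rewrite rnorm0 powR0// gt_eqF. Qed.




Lemma le_esumZ (c : R) (a : I -> \bar R) : 0 <= c -> (forall i, 0 <= a i)%E ->
  (\esum_(i in [set: I]) (c%:E * a i) <= c%:E * \esum_(i in [set: I]) a i)%E.
Proof.
move=> c0 a0; apply: ge_ereal_sup => _ [X XI <-].
rewrite -ge0_mule_fsumr//; apply: lee_pmul => //.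
  by apply: fsume_ge0.
by apply: ereal_sup_ubound; exists X.
Qed.

Lemma le_lp_massZ (a : R[i]) f :
  (lp_mass (fun i => a *: f i) <= (rnorm a `^ p)%:E * lp_mass f)%E.
Proof.
apply: le_trans (le_esumZ (powR_ge0 _ _) _); last first.
  by move=> i; rewrite lee_fin powR_ge0.
by apply: le_esum => i _; rewrite rnormZ powRM ?rnorm_ge0 ?EFinM.
Qed.

Let powRi (x : R) : 0 < x -> x^-1 `^ p = (x `^ p)^-1.
Proof.
by move=> x0; rewrite -powR_inv1 ?ltW// -powRrM mulN1r powRN.
Qed.

Lemma lp_mass_convex f g (s t : R) : 0 < s -> 0 < t ->
  (lp_mass f <= (s `^ p)%:E)%E -> (lp_mass g <= (t `^ p)%:E)%E ->
  (lp_mass (fun i => f i + g i)%R <= ((s + t) `^ p)%:E)%E.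
Proof.
move=> s0 t0 fs gt; have st0 : 0 < s + t by rewrite addr_gt0.
pose w := s / (s + t).
have w01 : 0 <= w <= 1.
  rewrite /w ler_pdivrMr// mul1r lerDl (ltW t0) andbT.
  by rewrite divr_ge0 // ltW.
pose c := (s + t) `^ p.
pose a := c * (w * (s `^ p)^-1); pose b := c * ((1 - w) * (t `^ p)^-1).
have c0 : 0 <= c by rewrite powR_ge0.
have a0 : 0 <= a.
  apply: mulr_ge0 => //; apply: mulr_ge0; first by case/andP: w01.
  by rewrite invr_ge0 powR_ge0.
have b0 : 0 <= b.
  apply: mulr_ge0 => //; apply: mulr_ge0.
    by rewrite subr_ge0; case/andP: w01.
  by rewrite invr_ge0 powR_ge0.
have termwise i : rnorm (f i + g i) `^ p <=
    a * rnorm (f i) `^ p + b * rnorm (g i) `^ p.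
  pose x := rnorm (f i) / s; pose y := rnorm (g i) / t.
  have x0 : 0 <= x by rewrite divr_ge0 ?rnorm_ge0 ?ltW.
  have y0 : 0 <= y by rewrite divr_ge0 ?rnorm_ge0 ?ltW.
  have xy : (w * x + (1 - w) * y) `^ p <= w * x `^ p + (1 - w) * y `^ p.
    have /andP[w0 w1] := w01.
    have := @convex_powR R (exponent_val p) (exponent_ge1 p) (Itv01 w0 w1) x y.
    rewrite !inE/= !in_itv/= !andbT => /(_ x0 y0).
    by rewrite !convRE.
  have -> : a * rnorm (f i) `^ p + b * rnorm (g i) `^ p =
      c * (w * x `^ p + (1 - w) * y `^ p).
    rewrite /x /y !powRM ?rnorm_ge0 ?invr_ge0 ?ltW// !powRi// /a /b.
    by ring.
  apply: le_trans (ler_wpM2l c0 xy).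
  have e : (w * x + (1 - w) * y) = (rnorm (f i) + rnorm (g i)) / (s + t).
    by rewrite /w /x /y; field; rewrite !gt_eqF.
  have -> : c * (w * x + (1 - w) * y) `^ p =
      (rnorm (f i) + rnorm (g i)) `^ p.
    rewrite e /c -powRM; first by rewrite mulrC divfK ?gt_eqF.
      exact: ltW.
    by rewrite divr_ge0 ?addr_ge0 ?rnorm_ge0// ltW.
  apply: ge0_ler_powR; rewrite ?nnegrE ?addr_ge0 ?rnorm_ge0 ?ler_rnormD//.
  exact: ltW.
apply: (@le_trans _ _ (a%:E * lp_mass f + b%:E * lp_mass g)%E).
  apply: (@le_trans _ _ (\esum_(i in [set: I])
      (a%:E * (rnorm (f i) `^ p)%:E + b%:E * (rnorm (g i) `^ p)%:E))%E).
    by apply: le_esum => i _; rewrite -!EFinM -EFinD lee_fin.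
  rewrite esumD; first last.
  - by move=> i _; rewrite -EFinM lee_fin mulr_ge0 ?powR_ge0.
  - by move=> i _; rewrite -EFinM lee_fin mulr_ge0 ?powR_ge0.
  by apply: leeD; apply: le_esumZ => // i; rewrite lee_fin powR_ge0.
apply: (@le_trans _ _ (a%:E * (s `^ p)%:E + b%:E * (t `^ p)%:E)%E).
  by apply: leeD; rewrite lee_wpmul2l ?lee_fin.
rewrite -!EFinM -EFinD lee_fin /a /b -!mulrA !mulVf ?gt_eqF ?powR_gt0//.
by rewrite !mulr1 -mulrDr subrKC mulr1.
Qed.

(* The norm (sum_i |f_i|^p)^(1/p). *)
Definition lp_norm f : R := fine (lp_mass f) `^ (p : R)^-1.

Lemma lp_norm_ge0 f : 0 <= lp_norm f. Proof. exact: powR_ge0. Qed.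

Lemma lp_mass_norm f : (lp_mass f < +oo)%E ->
  lp_mass f = (lp_norm f `^ p)%:E.
Proof.
move=> foo; rewrite /lp_norm -powRrM mulVf ?gt_eqF// powRr1.
  by rewrite fineK// ge0_fin_numE ?lp_mass_ge0.
by rewrite fine_ge0 ?lp_mass_ge0.
Qed.

Lemma lp_norm_le f (s : R) : 0 <= s -> (lp_mass f <= (s `^ p)%:E)%E ->
  lp_norm f <= s.
Proof.
move=> s0 fs; have foo : (lp_mass f < +oo)%E by apply: le_lt_trans fs (ltry _).
move: fs; rewrite lp_mass_norm// lee_fin.
apply: contraTT; rewrite -!ltNge => sf.
by rewrite gt0_ltr_powR ?nnegrE ?lp_norm_ge0.
Qed.

Lemma lp_finite0 : (lp_mass (fun i => 0 : V i)%R < +oo)%E.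
Proof. by rewrite lp_mass0 ltry. Qed.

Lemma lp_finiteZ (a : R[i]) f :
  (lp_mass f < +oo)%E -> (lp_mass (fun i => a *: f i) < +oo)%E.
Proof.
move=> foo; apply: le_lt_trans (le_lp_massZ a f) _.
by rewrite (lp_mass_norm foo) -EFinM ltry.
Qed.

Lemma lp_finiteN f :
  (lp_mass f < +oo)%E -> (lp_mass (fun i => - f i)%R < +oo)%E.
Proof.
move=> /(lp_finiteZ (-1)); congr (lp_mass _ < _)%E.
by apply: functional_extensionality_dep => i; rewrite scaleN1r.
Qed.

Lemma le_lp_normD f g : (lp_mass f < +oo)%E -> (lp_mass g < +oo)%E ->
  forall e, 0 < e -> 
  (lp_mass (fun i => f i + g i)%R <= ((lp_norm f + lp_norm g + e) `^ p)%:E)%E.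
Proof.
move=> foo goo e e0.
have -> : lp_norm f + lp_norm g + e = (lp_norm f + e / 2) + (lp_norm g + e / 2).
  by rewrite addrACA -splitr.
have e2 : 0 < e / 2 by rewrite divr_gt0.
apply: lp_mass_convex; rewrite ?ltr_wpDl ?lp_norm_ge0// lp_mass_norm// lee_fin;
by rewrite ge0_ler_powR ?nnegrE ?addr_ge0 ?lp_norm_ge0 ?lerDl// ltW.
Qed.

Lemma lp_finiteD f g : (lp_mass f < +oo)%E -> (lp_mass g < +oo)%E ->
  (lp_mass (fun i => f i + g i)%R < +oo)%E.
Proof.
by move=> foo goo; apply: le_lt_trans (le_lp_normD foo goo ltr01) (ltry _).
Qed.

Definition lp_zero : lp_sum := LpSum lp_finite0.
Definition lp_opp (f : lp_sum) : lp_sum := LpSum (lp_finiteN (lp_finite f)).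
Definition lp_add (f g : lp_sum) : lp_sum :=
  LpSum (lp_finiteD (lp_finite f) (lp_finite g)).
Definition lp_scale (a : R[i]) (f : lp_sum) : lp_sum :=
  LpSum (lp_finiteZ a (lp_finite f)).

Let addA : associative lp_add.
Proof. by move=> f g h; apply: lp_sumP => i; exact: addrA. Qed.
Let addC : commutative lp_add.
Proof. by move=> f g; apply: lp_sumP => i; exact: addrC. Qed.
Let add0 : left_id lp_zero lp_add.
Proof. by move=> f; apply: lp_sumP => i; exact: add0r. Qed.
Let addN : left_inverse lp_zero lp_opp lp_add.
Proof. by move=> f; apply: lp_sumP => i; exact: addNr. Qed.

HB.instance Definition _ := GRing.isZmodule.Build lp_sum addA addC add0 addN.

Let scaleA a b (f : lp_sum) : lp_scale a (lp_scale b f) = lp_scale (a * b) f.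
Proof. by apply: lp_sumP => i; exact: scalerA. Qed.
Let scale1 : left_id 1 lp_scale.
Proof. by move=> f; apply: lp_sumP => i; exact: scale1r. Qed.
Let scaleDr : right_distributive lp_scale +%R.
Proof. by move=> a f g; apply: lp_sumP => i; exact: scalerDr. Qed.
Let scaleDl (f : lp_sum) : {morph lp_scale^~ f : a b / a + b}.
Proof. by move=> a b; apply: lp_sumP => i; exact: scalerDl. Qed.

HB.instance Definition _ := GRing.Zmodule_isLmodule.Build R[i] lp_sum
  scaleA scale1 scaleDr scaleDl.

Let norm (f : lp_sum) : R[i] := (lp_norm f)%:C%C.

Let ler_normD (f g : lp_sum) : norm (f + g) <= norm f + norm g.
Proof.
rewrite /norm -rmorphD lecR; apply/ler_addgt0Pr => e e0.
apply: lp_norm_le; first by rewrite !addr_ge0 ?lp_norm_ge0 ?ltW.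
exact: (le_lp_normD (lp_finite f) (lp_finite g)).
Qed.

Let le_normZ (a : R[i]) (f : lp_sum) : lp_norm (a *: f) <= rnorm a * lp_norm f.
Proof.
apply: lp_norm_le; first by rewrite mulr_ge0 ?rnorm_ge0 ?lp_norm_ge0.
apply: le_trans (le_lp_massZ a f) _.
by rewrite (lp_mass_norm (lp_finite f)) -EFinM powRM ?rnorm_ge0 ?lp_norm_ge0.
Qed.

Let normr0_eq0 (f : lp_sum) : norm f = 0 -> f = 0.
Proof.
move=> /(@complexI R) f0; apply: lp_sumP => i /=; apply: rnorm_eq0.
have := lp_mass_norm (lp_finite f); rewrite f0 powR0 ?gt_eqF// => m0.
have : ((rnorm (f i) `^ p)%:E <= 0%:E)%E.
  rewrite -m0; apply: esum_ge; exists [set i]; first by split.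
  by rewrite fsbig_set1.
rewrite lee_fin => fi0; apply: (@powR_eq0_eq0 R _ p).
by apply/eqP; rewrite eq_le fi0 powR_ge0.
Qed.

Let normrZ (a : R[i]) (f : lp_sum) : norm (a *: f) = `|a| * norm f.
Proof.
have [->|a0] := eqVneq a 0.
  rewrite scale0r normr0 mul0r /norm.
  have := le_normZ 0 0; rewrite scale0r.
  rewrite rnorm0 mul0r => h; congr (_%:C)%C.
  by apply/eqP; rewrite eq_le h lp_norm_ge0.
rewrite /norm rnormE -rmorphM; congr (_%:C)%C.
apply/eqP; rewrite eq_le le_normZ/=.
have := le_normZ a^-1 (a *: f); rewrite scalerA mulVf// scale1r rnormV.
rewrite ler_pdivlMl// lt_neqAle rnorm_ge0 andbT eq_sym.
by apply: contra a0 => /eqP/rnorm_eq0 ->.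
Qed.

HB.instance Definition _ := Lmodule_isNormed.Build R[i] lp_sum
  ler_normD normrZ normr0_eq0.

Lemma lp_sum_normE (f : lp_sum) : `|f| = (lp_norm f)%:C%C.
Proof. by []. Qed.

Lemma lp_sum_addE (f g : lp_sum) i : (f + g) i = f i + g i.
Proof. by []. Qed.

Lemma lp_sum_scaleE (a : R[i]) (f : lp_sum) i : (a *: f) i = a *: f i.
Proof. by []. Qed.

End lp_sum.

Section lp_single.
Context {R : realType} (p : exponent R) {I : choiceType}
  (V : I -> normedModType R[i]).

Lemma lp_single_finite (i : I) (v : V i) :
  (lp_mass p (dfwith (fun j => 0%R : V j) i v) < +oo)%E.
Proof.
suff -> : lp_mass p (dfwith (fun j => 0%R : V j) i v) = (rnorm v `^ p)%:E.
  exact: ltry.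
rewrite -[in RHS](dfwithin (fun j => 0%R : V j) v).
rewrite -(@esum_set1 _ _ i
  (fun j => (rnorm (dfwith (fun j => 0%R : V j) i v j) `^ p)%:E)).
  rewrite [RHS]esum_mkcond; apply: eq_esum => j _; case: ifPn => //.
  rewrite notin_setE/= => /eqP ji; rewrite dfwithout; last by rewrite eq_sym.
  by rewrite rnorm0 powR0// gt_eqF// (lt_le_trans _ (exponent_ge1 p)).
by rewrite lee_fin powR_ge0.
Qed.

Definition lp_single (i : I) (v : V i) : lp_sum p V :=
  LpSum (lp_single_finite v).

End lp_single.

(** * Closed linear spans *)

Section closed_span.
Context {K : numFieldType} {V : normedModType K}.

Definition closed_subspace (W : set V) :=
  [/\ closed W, W 0 & forall (a : K) u v, W u -> W v -> W (a *: u + v)].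

Variable S : set V.

(* The closed linear span of S: the least closed subspace containing S.       *)
Definition closed_span : set V := smallest closed_subspace S.

Definition closed_span_pred : {pred V} := fun u => u \in closed_span.

Record closed_span_space := ClosedSpan {
  cspan_val :> V;
  cspan_mem : cspan_val \in closed_span_pred }.

HB.instance Definition _ := [isSub for cspan_val].
HB.instance Definition _ := [Choice of closed_span_space by <:].

Fact closed_span_submod : submod_closed closed_span_pred.
Proof.
split; first by apply/mem_set => W [[_ W0 _] _].
move=> a u v /set_mem uS /set_mem vS; apply/mem_set => W SW.
by have [[_ _ WD] _] := SW; apply: WD; [exact: uS|exact: vS].
Qed.

HB.instance Definition _ := GRing.isSubmodClosed.Build K V
  closed_span_pred closed_span_submod.
HB.instance Definition _ :=
  [SubChoice_isSubLmodule of closed_span_space by <:].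

Let norm (u : closed_span_space) : K := `|(u : V)|.

Let ler_normD (u v : closed_span_space) : norm (u + v) <= norm u + norm v.
Proof. exact: ler_normD. Qed.
Let normrZ (a : K) (u : closed_span_space) : norm (a *: u) = `|a| * norm u.
Proof. exact: normrZ. Qed.
Let normr0_eq0 (u : closed_span_space) : norm u = 0 -> u = 0.
Proof. by move=> /normr0_eq0 u0; apply: val_inj. Qed.

HB.instance Definition _ := Lmodule_isNormed.Build K closed_span_space
  ler_normD normrZ normr0_eq0.

Lemma closed_span_normE (u : closed_span_space) : `|u| = `|(u : V)|.
Proof. by []. Qed.

End closed_span.

(** * The space X *)

Section X_construction.
Context {R : realType}.

(* The common difference of the reciprocals of p_1, ..., p_5. *)
Definition eta (e : nat -> R) : R := (e 2%N)^-1 - (e 1%N)^-1.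

(* X_{k,m} for fixed (k,m): [e j] is the exponent p_j(k,m), 1 <= j <= 5.      *)
Section X_component.
Variables (p : exponent R) (k : nat) (e : nat -> exponent R).

Definition eta_km : R := eta (fun j => e j).

Definition N_km : nat := Num.truncn ((k.+1)%:R `^ eta_km^-1 : R).

(* gamma a = N^(- a eta): the weights gamma_1, gamma_2, gamma_3 are
   gamma 2, gamma 8 and gamma 24. *)
Definition gamma (a : R) : R := N_km%:R `^ (- (a * eta_km)).

(* The summand of index j : 'I_5 is l_{p_(j+1)}. *)
Definition ell5 : normedModType R[i] :=
  lp_sum p (fun j : 'I_5 => lp_sum (e j.+1) (fun _ : nat => R[i]^o)).

(* The basis vector f_{j,t}, with 1-based j. *)
Definition fvec (j : nat) (hj : (j.-1 < 5)%N) (t : nat) : ell5 :=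
  lp_single p (i := Ordinal hj) (lp_single (e j.-1.+1) (i := t) (1 : R[i]^o)).

Definition xvec (t : nat) : ell5 :=
  fvec (j := 1%N) isT t + (gamma 2)%:C%C *: fvec (j := 3%N) isT t
  + (gamma 8)%:C%C *: fvec (j := 4%N) isT t
  + (gamma 24)%:C%C *: fvec (j := 5%N) isT t.

Definition yvec (t : nat) : ell5 :=
  fvec (j := 2%N) isT t + (gamma 8)%:C%C *: fvec (j := 4%N) isT t
  + ('i%C * (gamma 24)%:C%C) *: fvec (j := 5%N) isT t.

Definition X_component : normedModType R[i] :=
  closed_span_space (range xvec `|` range yvec).

End X_component.

(* Summation over k, m >= 1 is indexed by nat with a shift of one. *)
Definition X_complex (p : exponent R) (P : nat -> nat -> nat -> exponent R) :
    normedModType R[i] :=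
  lp_sum p (fun k : nat => lp_sum p (fun m : nat =>
    X_component p k.+1 (P k.+1 m.+1))).

(* The immediate successor of (k,m) in the order                              *)
(* (1,1),(1,2),(2,1),(1,3),(2,2),(3,1),...                                    *)
Definition succ_pair (k m : nat) : nat * nat :=
  if (m <= 1)%N then (1%N, k.+1) else (k.+1, m.-1).

Record admissible (p : R) (q : nat -> nat -> R)
    (P : nat -> nat -> nat -> R) : Prop := Admissible {
  q_range : forall k m, (0 < k)%N -> (0 < m)%N -> p < q k m <= 2;
  q_decr : forall k m, (0 < k)%N -> (0 < m)%N -> q k m.+1 < q k m;
  q_cvg : forall k, (0 < k)%N -> (q k m @[m --> \oo] --> p);
  q_order : forall k m, (0 < k)%N -> (0 < m)%N ->
    q k m.+1 > q k.+1 m /\ q k.+1 m > q 1%N (m + k + 1)%N;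
  P_range : forall k m, (0 < k)%N -> (0 < m)%N ->
    q k m > P k m 1%N /\ P k m 5%N > q (succ_pair k m).1 (succ_pair k m).2;
  P_decr : forall k m j, (0 < k)%N -> (0 < m)%N -> (1 <= j < 5)%N ->
    P k m j > P k m j.+1;
  P_step : forall k m j, (0 < k)%N -> (0 < m)%N -> (1 <= j < 5)%N ->
    (P k m j.+1)^-1 - (P k m j)^-1 = eta (P k m);
  P_gap : forall k m, (0 < k)%N -> (0 < m)%N ->
    ((m + k - 1) * (m + k))%N%:R / 2 * eta (P k m)
      < (P k m 1%N)^-1 - (q k m)^-1 }.

End X_construction.

(* Main.v *)
From HB Require Import structures.
Require Import Defs.
From mathcomp Require Import all_boot all_order all_algebra.
From mathcomp Require Import all_classical all_reals all_analysis.
From mathcomp Require Import ring lra zify complex.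

Set Implicit Arguments.
Unset Strict Implicit.
Unset Printing Implicit Defensive.

Import Order.TTheory GRing.Theory Num.Theory.
Import numFieldNormedType.Exports.

Local Open Scope classical_set_scope.
Local Open Scope ring_scope.

(** Reals are coded by the bits [x k < r_m], [r_m] running over the rationals.
    The reduction sends the bits [al k m] to the complex structure of [X] that
    is multiplication by [i] or by [- i] on [X_{k,m}] according to [al k m].

    Put [w = N ^ eta], so that [k <= w <= k + 1].  In the coordinates
    [z = sum_t a_t x_t + b_t y_t], an antilinear map of [X_{k,m}] which
    conjugates both [a + b] and [a + i b] has norm at most [20 w ^ 24], which
    does not depend on [m]: hence [E_1]-equivalent sequences give isomorphic
    structures.

    Conversely let [T] be bounded by [C], bounded below by [1 / C], and
    antilinear from [X_{k,m}] to its own coordinates.  A gliding hump makes the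
    images of far away [x_t], [y_t] almost disjoint, so that the norm of a sum
    of [M] of them can be compared in each [l_{p_j}].  With [M] equal to [N],
    [N ^ 4], [N ^ 10], [N ^ 18] in turn, [T] must nearly preserve each of the
    four lines [b = 0], [a = 0], [a + b = 0], [a + i b = 0] of [C ^ 2]; since
    their cross-ratio is not real, an antilinear map doing so is small, of order
    [C / w] on [y].  The images in later components tend to zero (their exponents
    are smaller than [p_5]), and those in the finitely many earlier ones are
    negligible on a sum of [N] vectors, by the gap condition on the exponents.
    Testing on the sum of [N] vectors [y_t] gives [w <= 47 C ^ 2]. *)

(** * Norms of l_p-sums *)

(* A copy of [rnorm] that conversion cannot unfold. *)
HB.lock Definition nrm (R : realType) (V : normedZmodType R[i]) (x : V) : R :=
  rnorm x.
Arguments nrm {R V} x.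

Section nrm_theory.
Context {R : realType} {V : normedZmodType R[i]}.
Implicit Types x y : V.

Lemma nrmE x : nrm x = rnorm x.
Proof. by rewrite nrm.unlock. Qed.

Lemma nrm_ge0 x : 0 <= nrm x.
Proof. by rewrite nrmE rnorm_ge0. Qed.

Lemma nrm0 : nrm (0 : V) = 0.
Proof. by rewrite nrmE rnorm0. Qed.

Lemma ler_nrmD x y : nrm (x + y) <= nrm x + nrm y.
Proof. by rewrite !nrmE ler_rnormD. Qed.

Lemma nrmN x : nrm (- x) = nrm x.
Proof. by rewrite !nrmE /rnorm normrN. Qed.

Lemma ler_nrmB x y : nrm (x - y) <= nrm x + nrm y.
Proof. by rewrite (le_trans (ler_nrmD _ _))// nrmN. Qed.

Lemma ler_distB_nrm x y : nrm x - nrm y <= nrm (x - y).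
Proof. by rewrite lerBlDr -{1}(subrK y x) ler_nrmD. Qed.

Lemma ler_nrm_sum (J : Type) (r : seq J) (Q : pred J) (F : J -> V) :
  nrm (\sum_(j <- r | Q j) F j) <= \sum_(j <- r | Q j) nrm (F j).
Proof.
elim/big_ind2 : _ => [|x s y t xs yt|//]; first by rewrite nrm0.
by rewrite (le_trans (ler_nrmD _ _))// lerD.
Qed.

End nrm_theory.

Lemma nrmZ (R : realType) (V : normedModType R[i]) (a : R[i]) (x : V) :
  nrm (a *: x) = nrm a * nrm x.
Proof. by rewrite !nrmE rnormZ. Qed.

Section nrm_complex.
Context {R : realType}.
Implicit Types a b : R[i].

Lemma nrmM a b : nrm (a * b) = nrm a * nrm b.
Proof.
by rewrite !nrmE; apply: complexI; rewrite rmorphM/= -!rnormE normrM.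
Qed.

Lemma nrmC (x : R) : nrm (x%:C%C : R[i]) = `|x|.
Proof. by rewrite nrmE rnormC. Qed.

Lemma nrmV a : nrm a^-1 = (nrm a)^-1.
Proof. by rewrite !nrmE rnormV. Qed.

Lemma nrm1 : nrm (1 : R[i]) = 1.
Proof. by rewrite (nrmC 1) normr1. Qed.

Lemma nrmi : nrm ('i%C : R[i]) = 1.
Proof.
by rewrite nrmE /rnorm normc_def/= expr0n/= add0r expr1n sqrtr1.
Qed.

Lemma nrm_conjc a : nrm (a^*)%C = nrm a.
Proof. by case: a => a b; rewrite !nrmE /rnorm !normc_def/= sqrrN. Qed.

Lemma ler_Re_nrm a : `|complex.Re a| <= nrm a.
Proof.
case: a => a b; rewrite nrmE /rnorm normc_def/= -sqrtr_sqr ler_wsqrtr//.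
by rewrite lerDl sqr_ge0.
Qed.

Lemma ler_Im_nrm a : `|complex.Im a| <= nrm a.
Proof.
case: a => a b; rewrite nrmE /rnorm normc_def/= -sqrtr_sqr ler_wsqrtr//.
by rewrite lerDr sqr_ge0.
Qed.

Lemma ler_nrm_ReIm a : nrm a <= `|complex.Re a| + `|complex.Im a|.
Proof.
rewrite {1}[a]complexE; apply: le_trans (ler_nrmD _ _) _.
by rewrite nrmM nrmi mul1r !nrmC.
Qed.

End nrm_complex.

Lemma exponent_gt0 (R : realType) (p : exponent R) : 0 < (p : R).
Proof. exact: lt_le_trans (exponent_ge1 p). Qed.
#[global] Hint Resolve exponent_gt0 : core.

Lemma exponent_neq0 (R : realType) (p : exponent R) : (p : R) != 0.
Proof. by rewrite gt_eqF// exponent_gt0. Qed.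
#[global] Hint Resolve exponent_neq0 : core.

Section lp_sum_norms.
Context {R : realType} (p : exponent R) {I : choiceType}.

Section one.
Context {V : I -> normedModType R[i]}.

Lemma lp_mass_esum (f : forall i, V i) :
  lp_mass p f = \esum_(i in [set: I]) (nrm (f i) `^ p)%:E.
Proof. by apply: eq_esum => i _; rewrite nrmE. Qed.

Lemma lp_massE (f : lp_sum p V) : lp_mass p f = (nrm f `^ p)%:E.
Proof. by rewrite (lp_mass_norm (lp_finite f)) nrmE. Qed.

Lemma nrm_lp_le (f : lp_sum p V) (s : R) :
  0 <= s -> (lp_mass p f <= (s `^ p)%:E)%E -> nrm f <= s.
Proof. by rewrite nrmE; exact: lp_norm_le. Qed.

End one.

Section two.
Context {V W : I -> normedModType R[i]}.

(** Stated for a bare family [f], so that it also yields the finiteness needed to build new elements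
    of the sum coordinate by coordinate. *)
Lemma lp_mass_dom (c : R) (f : forall i, V i) (g : lp_sum p W) : 0 <= c ->
  (forall i, nrm (f i) <= c * nrm (g i)) ->
  (lp_mass p f <= ((c * nrm g) `^ p)%:E)%E.
Proof.
move=> c0 fg; rewrite powRM ?nrm_ge0// EFinM -(lp_massE g) !lp_mass_esum.
apply: le_trans (le_esumZ (powR_ge0 _ _) _); last first.
  by move=> i; rewrite lee_fin powR_ge0.
apply: le_esum => i _; rewrite -EFinM -powRM ?nrm_ge0// lee_fin.
by rewrite ge0_ler_powR ?nnegrE ?mulr_ge0 ?nrm_ge0// ltW.
Qed.

Lemma lp_finite_dom (c : R) (f : forall i, V i) (g : lp_sum p W) : 0 <= c ->
  (forall i, nrm (f i) <= c * nrm (g i)) -> (lp_mass p f < +oo)%E.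
Proof.
by move=> c0 fg; apply: le_lt_trans (lp_mass_dom c0 fg) (ltry _).
Qed.

Lemma nrm_lp_dom (c : R) (f : lp_sum p V) (g : lp_sum p W) : 0 <= c ->
  (forall i, nrm (f i) <= c * nrm (g i)) -> nrm f <= c * nrm g.
Proof.
move=> c0 fg; apply: nrm_lp_le; first by rewrite mulr_ge0 ?nrm_ge0.
exact: lp_mass_dom.
Qed.

Lemma nrm_lp_dom1 (f : lp_sum p V) (g : lp_sum p W) :
  (forall i, nrm (f i) <= nrm (g i)) -> nrm f <= nrm g.
Proof.
move=> fg; rewrite -[leRHS]mul1r; apply: nrm_lp_dom => // i.
by rewrite mul1r.
Qed.

End two.

Context {V : I -> normedModType R[i]}.

Lemma nrm_lp_coord (f : lp_sum p V) i : nrm (f i) <= nrm f.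
Proof.
have : ((nrm (f i) `^ p)%:E <= (nrm f `^ p)%:E)%E.
  rewrite -lp_massE lp_mass_esum; apply: esum_ge; exists [set i]; first by split.
  by rewrite fsbig_set1.
rewrite lee_fin; apply: contraTT; rewrite -!ltNge => fi.
by rewrite gt0_ltr_powR ?nnegrE ?nrm_ge0.
Qed.

Lemma lp_sumNE (f : lp_sum p V) i : (- f) i = - f i.
Proof. by []. Qed.

Lemma lp_sum_sumE (J : Type) (r : seq J) (Q : pred J) (F : J -> lp_sum p V) i :
  (\sum_(j <- r | Q j) F j) i = \sum_(j <- r | Q j) F j i.
Proof. by elim/big_rec2 : _ => // j x y _ <-. Qed.

Lemma nrm_lp_single i (v : V i) : nrm (lp_single p v) = nrm v.
Proof.
apply/eqP; rewrite eq_le; apply/andP; split; last first.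
  have := nrm_lp_coord (lp_single p v) i.
  by rewrite /= dfwithin.
apply: nrm_lp_le; first exact: nrm_ge0.
rewrite lp_mass_esum (@esumID _ _ [set i])/=; last first.
  by move=> j _; rewrite lee_fin powR_ge0.
rewrite setTI esum_set1 ?lee_fin ?powR_ge0// dfwithin.
rewrite esum1 ?adde0// => j [_ /= /eqP ji].
rewrite dfwithout; last by rewrite eq_sym.
by rewrite nrm0 powR0.
Qed.

Section restriction.
Variable D : pred I.

Definition lp_restr_fun (f : lp_sum p V) i : V i := if D i then f i else 0.

Lemma lp_restr_finite f : (lp_mass p (lp_restr_fun f) < +oo)%E.
Proof.
apply: (le_lt_trans _ (lp_finite f)); rewrite !lp_mass_esum.
apply: le_esum => i _; rewrite lee_fin /lp_restr_fun; case: (D i) => //.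
by rewrite nrm0 powR0// powR_ge0.
Qed.

Definition lp_restr f : lp_sum p V := LpSum (lp_restr_finite f).

Lemma lp_restrE f i : lp_restr f i = if D i then f i else 0.
Proof. by []. Qed.

Lemma nrm_lp_restr f : nrm (lp_restr f) <= nrm f.
Proof.
by apply: nrm_lp_dom1 => i; rewrite lp_restrE; case: (D i); rewrite ?nrm0 ?nrm_ge0.
Qed.

Lemma lp_restrB f g : lp_restr (f - g) = lp_restr f - lp_restr g.
Proof.
apply: lp_sumP => i; rewrite lp_sum_addE lp_sumNE !lp_restrE lp_sum_addE lp_sumNE.
by case: (D i); rewrite ?subr0.
Qed.

Lemma lp_restr_sum (J : Type) (r : seq J) (F : J -> lp_sum p V) :
  lp_restr (\sum_(j <- r) F j) = \sum_(j <- r) lp_restr (F j).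
Proof.
apply: lp_sumP => i; rewrite lp_sum_sumE lp_restrE lp_sum_sumE.
by case: ifPn => Di; [|rewrite big1//]; [apply: eq_bigr|]; move=> j _;
  rewrite lp_restrE ?Di// (negPf Di).
Qed.

End restriction.

Lemma nrm_lp_fin (r : seq I) (f : lp_sum p V) :
  (forall i, i \notin r -> f i = 0) -> nrm f <= \sum_(i <- undup r) nrm (f i).
Proof.
move=> fr.
have {1}-> : f = \sum_(i <- undup r) lp_single p (f i).
  apply: lp_sumP => i; rewrite lp_sum_sumE.
  have [ir|ir] := boolP (i \in undup r).
    rewrite (bigD1_seq i) ?undup_uniq//= dfwithin big1 ?addr0// => j ji.
    by rewrite dfwithout.
  rewrite fr -?(mem_undup r)// big1_seq// => j /= jr.
  rewrite dfwithout//; apply: contraNneq ir => <-; exact: jr.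
apply: le_trans (ler_nrm_sum _ _ _) _.
by apply: ler_sum => i _; rewrite nrm_lp_single.
Qed.

(** The mass is a supremum of finite partial sums: a finite set carrying more than
    [nrm f ^ p - e ^ p] leaves at most [e ^ p] outside. *)
Lemma lp_tail (f : lp_sum p V) (e : R) : 0 < e ->
  exists r : seq I, nrm (lp_restr (fun i => i \notin r) f) <= e.
Proof.
move=> e0; have ep : 0 < e `^ p by rewrite powR_gt0.
have : ((nrm f `^ p - e `^ p)%:E < lp_mass p f)%E.
  by rewrite lp_massE lte_fin ltrBlDr ltrDl.
rewrite lp_mass_esum; move=> /ereal_sup_gt[_ [F [finF _] <-] Fm].
have [r rF] : exists r : seq I, F = [set` r].
  by apply/finite_seqP.
exists r; apply: nrm_lp_le; first exact: ltW.
suff ts : nrm (lp_restr (fun i => i \notin r) f) `^ p <= e `^ p.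
  by rewrite (lp_massE (lp_restr _ f)) lee_fin.
have tail : lp_mass p (lp_restr (fun i => i \notin r) f) =
    \esum_(i in ~` F) (nrm (f i) `^ p)%:E.
  rewrite lp_mass_esum [RHS]esum_mkcond; apply: eq_esum => i _; rewrite lp_restrE.
  rewrite rF; have [ir|ir] := boolP (i \in r) => /=.
    by rewrite memNset ?nrm0 ?powR0//= => /negP.
  by rewrite mem_set//=; apply/negP.
have := lp_massE f; rewrite lp_mass_esum (@esumID _ _ F)/=; last first.
  by move=> i _; rewrite lee_fin powR_ge0.
rewrite !setTI -tail (esum_fset finF); last first.
  by move=> i _; rewrite lee_fin powR_ge0.
rewrite (lp_massE (lp_restr _ f)).
move: Fm; set S := (\sum_(_ \in F) _)%E.
have : (0 <= S)%E by apply: fsume_ge0 => i _; rewrite lee_fin powR_ge0.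
case: S => [s| |]//= _; rewrite lte_fin => es; rewrite -EFinD => -[fs].
by rewrite -(lerD2l s) fs -lerBlDr ltW.
Qed.

End lp_sum_norms.

(** * Disjoint sums and inclusions *)

Section powR_more.
Context {R : realType}.
Implicit Types (x y t : R).

(** Power mean inequality. In the induction, convexity is applied to the mean of the first terms and
    the new term, with weights proportional to their numbers. *)
Lemma powR_sum_le (M : nat) (y : nat -> R) t : 1 <= t ->
  (forall l, 0 <= y l) ->
  (\sum_(l < M) y l) `^ t <= M%:R `^ (t - 1) * \sum_(l < M) y l `^ t.
Proof.
move=> t1 y0; have t0 : t != 0 by rewrite gt_eqF// (lt_le_trans ltr01).
elim: M => [|M IH]; first by rewrite !big_ord0 powR0// mulr0.
rewrite !big_ord_recr/=; set S := \sum_(l < M) y l; set T := \sum_(l < M) _.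
have S0 : 0 <= S by exact: sumr_ge0.
have T0 : 0 <= T by apply: sumr_ge0 => l _; exact: powR_ge0.
(* The mean [S / m] requires at least one earlier term, so a single summand is treated apart. *)
case: M => [|M] in S T IH S0 T0 *.
  by rewrite /S /T !big_ord0 !add0r powR1 mul1r.
set m : R := M.+1%:R in IH *; have m0 : 0 < m by rewrite ltr0n.
have -> : M.+2%:R = m + 1 :> R by rewrite /m natr1.
have m10 : 0 < m + 1 by rewrite addr_gt0.
pose w := m / (m + 1).
have w01 : 0 <= w <= 1.
  by apply/andP; split; [rewrite divr_ge0 ?ltW|rewrite ler_pdivrMr// mul1r lerDl].
have cv : (w * (S / m) + (1 - w) * y M.+1) `^ t <=
    w * (S / m) `^ t + (1 - w) * y M.+1 `^ t.
  have /andP[w0 w1] := w01.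
  have := @convex_powR R t t1 (Itv01 w0 w1) (S / m) (y M.+1).
  rewrite !inE/= !in_itv/= !andbT => /(_ _ _).
  by rewrite !convRE; apply; rewrite ?divr_ge0// ltW.
have -> : S + y M.+1 = (m + 1) * (w * (S / m) + (1 - w) * y M.+1).
  by rewrite /w; field; rewrite !gt_eqF.
have /andP[w0 w1] := w01.
rewrite powRM ?(ltW m10)//; last first.
  by rewrite addr_ge0// mulr_ge0// ?subr_ge0// ?divr_ge0// ltW.
apply: le_trans (ler_wpM2l (powR_ge0 _ _) cv) _.
have mt : (m + 1) `^ t = (m + 1) `^ (t - 1) * (m + 1).
  by rewrite -{3}(powRr1 (ltW m10)) -powRD ?subrK// (negPf t0).
rewrite mt -mulrA ler_wpM2l ?powR_ge0//.
have -> : (m + 1) * (w * (S / m) `^ t + (1 - w) * y M.+1 `^ t) =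
    m * (S / m) `^ t + y M.+1 `^ t.
  by rewrite /w; field; rewrite !gt_eqF.
rewrite lerD2r powRM ?invr_ge0 ?(ltW m0)// -powR_inv1 ?(ltW m0)// -powRrM mulN1r.
apply: le_trans (_ : m * (m `^ (t - 1) * T * m `^ (- t)) <= _).
  by rewrite ler_wpM2l ?(ltW m0)// ler_wpM2r ?powR_ge0.
have -> : m * (m `^ (t - 1) * T * m `^ (- t)) =
  m `^ 1 * m `^ (t - 1) * m `^ (- t) * T by rewrite powRr1 ?(ltW m0)//; ring.
rewrite -!powRD ?(gt_eqF m0) ?implybT//.
by rewrite addrCA subrr addr0 subrr powRr0 mul1r.
Qed.

Lemma powR_expand x (a : R) : 1 <= x -> 0 <= a -> 1 <= x `^ a.
Proof. by move=> x1 a0; rewrite -(powRr0 x) ler_powR. Qed.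

Lemma exists_nat_powR_gt (a B : R) : 0 < a -> exists M : nat,
  (0 < M)%N /\ B < M%:R `^ a.
Proof.
move=> a0; pose C := Num.max B 1.
have C0 : 0 < C by rewrite lt_max ltr01 orbT.
exists (Num.truncn (C `^ a^-1)).+1; split => //.
apply: le_lt_trans (_ : C < _); first by rewrite le_max lexx.
have {1}-> : C = (C `^ a^-1) `^ a.
  by rewrite -powRrM mulVf ?(lt0r_neq0 a0)// powRr1 ?(ltW C0).
by rewrite gt0_ltr_powR ?nnegrE ?powR_ge0// truncnS_gt.
Qed.

End powR_more.

Section disjoint.
Context {R : realType}.

Lemma nrm_disjoint_powR (V : normedModType R[i]) (M : nat) (F : nat -> V)
  (p : R) : p != 0 ->
  (forall l l', l != l' -> F l = 0 \/ F l' = 0) ->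
  nrm (\sum_(l < M) F l) `^ p = \sum_(l < M) nrm (F l) `^ p.
Proof.
move=> p0 dF; have [[l0 F0]|F0] := pselect (exists l0 : 'I_M, F l0 != 0).
  have Fl l : l != l0 -> F l = 0.
    move=> ll0; have [//|Fl0] := dF l l0 ll0.
    by rewrite Fl0 eqxx in F0.
  rewrite (bigD1 l0)//= [in RHS](bigD1 l0)//= !big1 ?addr0// => l ll0.
  by rewrite Fl ?nrm0 ?powR0.
have {}F0 (l : 'I_M) : F l = 0.
  by apply/eqP/negPn/negP => Fl; apply: F0; exists l.
rewrite !big1 ?nrm0 ?powR0// => l _; by rewrite F0 ?nrm0 ?powR0.
Qed.

Lemma nrm_lp_disjoint (p : exponent R) (I : choiceType)
  (V : I -> normedModType R[i]) (M : nat) (u : nat -> lp_sum p V) :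
  (forall l l' i, l != l' -> u l i = 0 \/ u l' i = 0) ->
  nrm (\sum_(l < M) u l) `^ p = \sum_(l < M) nrm (u l) `^ p.
Proof.
move=> du; apply: EFin_inj; rewrite -(lp_massE (\sum_(l < M) u l)) -sumEFin.
rewrite (eq_bigr (fun l : 'I_M => lp_mass p (u l))); last first.
  by move=> l _; rewrite -lp_massE.
rewrite lp_mass_esum (eq_bigr _ (fun l _ => lp_mass_esum p (u (nat_of_ord l)))).
rewrite -esum_sum//; last by move=> i l _ _; rewrite lee_fin powR_ge0.
apply: eq_esum => i _; rewrite sumEFin lp_sum_sumE.
rewrite (@nrm_disjoint_powR _ _ (fun l => u l i))// => l l'; exact: du.
Qed.

End disjoint.

Section inclusion.
Context {R : realType} (s s' : exponent R) (ss' : (s : R) <= (s' : R))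
  {I : choiceType} {V : I -> normedModType R[i]}.

(** Write [|f_i|^s'] as [|f_i|^(s' - s) |f_i|^s] and bound the first factor by the norm: the
    inclusion of the smaller exponent into the larger one is contractive. *)
Lemma lp_mass_incl (f : lp_sum s V) : (lp_mass s' f <= (nrm f `^ s')%:E)%E.
Proof.
have powD x : x `^ s' = x `^ ((s' : R) - (s : R)) * x `^ s.
  by rewrite -powRD ?subrK// (negPf (exponent_neq0 s')).
rewrite powD EFinM -lp_massE !lp_mass_esum.
apply: le_trans (le_esumZ (powR_ge0 _ _) _); last first.
  by move=> i; rewrite lee_fin powR_ge0.
apply: le_esum => i _; rewrite powD EFinM lee_wpmul2r ?lee_fin ?powR_ge0//.
by rewrite ge0_ler_powR ?subr_ge0 ?nnegrE ?nrm_ge0// nrm_lp_coord.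
Qed.

Lemma lp_finite_incl (f : lp_sum s V) : (lp_mass s' f < +oo)%E.
Proof. by apply: le_lt_trans (lp_mass_incl f) (ltry _). Qed.

Lemma nrm_lp_incl (f : lp_sum s V) (g : lp_sum s' V) :
  (forall i, g i = f i) -> nrm g <= nrm f.
Proof.
move=> gf; apply: nrm_lp_le; first exact: nrm_ge0.
rewrite (_ : lp_mass s' g = lp_mass s' f); first exact: lp_mass_incl.
by apply: eq_esum => i _; rewrite gf.
Qed.

End inclusion.

Section lp_map.
Context {R : realType} (p : exponent R) {I : choiceType}
  {V W : I -> normedModType R[i]}.
Variables (c : R) (c0 : 0 <= c) (g : forall i, V i -> W i).
Hypothesis gc : forall i (x : V i), nrm (@g i x) <= c * nrm x.

Definition lp_map (f : lp_sum p V) : lp_sum p W :=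
  LpSum (lp_finite_dom (f := fun i => @g i (f i)) c0 (fun i => @gc i (f i))).

Lemma nrm_lp_map f : nrm (lp_map f) <= c * nrm f.
Proof. by apply: nrm_lp_dom => // i; exact: gc. Qed.

End lp_map.

(** * The gliding hump *)

Section flat.
Context {R : realType} (p : exponent R) {I : choiceType} (s : I -> exponent R).

(** The common ambient space: [ell5] is the case of five indices, and [X] embeds isometrically with
    one index for each triple [(k, m, j)]. *)
Definition flat : normedModType R[i] :=
  lp_sum p (fun i : I => lp_sum (s i) (fun _ : nat => R[i]^o)).

Implicit Types (f g : flat) (D : I -> pred nat).

Let restr_le D i (x : lp_sum (s i) (fun _ : nat => R[i]^o)) :
  nrm (lp_restr (D i) x) <= 1 * nrm x.
Proof. by rewrite mul1r nrm_lp_restr. Qed.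

Definition flat_restr D : flat -> flat :=
  lp_map (p := p) ler01 (@restr_le D).

Lemma flat_restrE D f i n : flat_restr D f i n = if D i n then f i n else 0.
Proof. by []. Qed.

Lemma flatP f g : (forall i n, f i n = g i n) -> f = g.
Proof. by move=> fg; apply: lp_sumP => i; apply: lp_sumP => n; exact: fg. Qed.

Lemma flat_addE f g i n : (f + g) i n = f i n + g i n.
Proof. by []. Qed.

Lemma flat_oppE f i n : (- f) i n = - f i n.
Proof. by []. Qed.

Lemma flat_sumE (J : Type) (r : seq J) (Q : pred J) (F : J -> flat) i n :
  (\sum_(j <- r | Q j) F j) i n = \sum_(j <- r | Q j) F j i n.
Proof. by rewrite lp_sum_sumE lp_sum_sumE. Qed.

Lemma nrm_flat_coord f i n : nrm (f i n) <= nrm f.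
Proof. exact: le_trans (nrm_lp_coord (f i) n) (nrm_lp_coord f i). Qed.

Definition window (F : seq I * nat) : I -> pred nat :=
  fun i n => (i \in F.1) && (n < F.2)%N.

Definition subwindow (F G : seq I * nat) : Prop :=
  {subset F.1 <= G.1} /\ (F.2 <= G.2)%N.

Lemma subwindowP F G i n : subwindow F G -> window F i n -> window G i n.
Proof.
by move=> [FG1 FG2] /andP[/FG1 iG n1]; apply/andP; split => //; exact: leq_trans FG2.
Qed.

(** Half of [e] pays for cutting the outer sum to a finite list, the other half is shared among the
    inner tails of that list. Containing a given [F0] is what makes the windows of the gliding hump
    nested. *)
Lemma flat_tail f (e : R) F0 : 0 < e -> exists F, subwindow F0 F /\
  nrm (f - flat_restr (window F) f) <= e.
Proof.
move=> e0; have e20 : 0 < e / 2 by rewrite divr_gt0.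
have [r rP] := lp_tail f e20.
have tl i : exists n, forall n', (n <= n')%N ->
    nrm (f i - lp_restr (fun m => (m < n')%N) (f i)) <=
    e / 2 / (size r).+1%:R.
  have [r' r'P] := @lp_tail _ _ _ _ (f i) (e / 2 / (size r).+1%:R)
    (divr_gt0 e20 (ltr0Sn _ _)).
  exists (\max_(m <- r') m.+1) => n' rn'; apply: le_trans r'P.
  apply: nrm_lp_dom1 => m; rewrite lp_sum_addE lp_sumNE !lp_restrE.
  case: ifPn; rewrite ?subrr ?nrm0 ?nrm_ge0// subr0 -leqNgt => n'm.
  case: ifPn => //; rewrite negbK => mr'.
  by have := leq_trans (@leq_bigmax_seq _ r' xpredT (fun m => m.+1) m mr' isT) rn'; lia.
have [n nP] := choice tl.
pose N := maxn F0.2 (\max_(i <- r) n i).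
exists (F0.1 ++ r, N); split.
  by split => [i|]; rewrite ?mem_cat ?leq_maxl// => ->.
set g := f - _.
have -> : g = lp_restr (fun i => i \notin r) g + lp_restr (fun i => i \in r) g.
  apply: lp_sumP => i; rewrite lp_sum_addE !lp_restrE.
  by case: (i \in r); rewrite ?addr0 ?add0r.
rewrite (splitr e); apply: le_trans (ler_nrmD _ _) _; apply: lerD.
  apply: le_trans rP; apply: nrm_lp_dom1 => i; rewrite !lp_restrE.
  case: ifP => _; last by rewrite !nrm0.
  apply: nrm_lp_dom1 => m.
  rewrite /g lp_sum_addE lp_sumNE !flat_restrE.
  by case: ifP; rewrite ?subrr ?subr0 ?nrm0 ?nrm_ge0.
apply: le_trans (nrm_lp_fin (r := r) _) _ => [i ir|].
  by rewrite lp_restrE (negPf ir).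
apply: le_trans (_ : \sum_(i <- undup r) (e / 2 / (size r).+1%:R) <= _).
  rewrite big_seq_cond [leRHS]big_seq_cond; apply: ler_sum => i.
  rewrite andbT mem_undup => ir; rewrite lp_restrE ir.
  have nN : (n i <= N)%N.
    by rewrite leq_max (leq_bigmax_seq i ir isT) orbT.
  apply: le_trans (nP i N nN); rewrite le_eqVlt; apply/orP; left.
  apply/eqP; congr nrm; apply: lp_sumP => m.
  rewrite flat_addE flat_oppE flat_restrE lp_sum_addE lp_sumNE lp_restrE.
  by rewrite /window/= mem_cat ir orbT.
rewrite big_const_seq count_predT iter_addr_0 -[leLHS]mulr_natr -mulrA ler_piMr ?(ltW e20)//.
rewrite mulrC ler_pdivrMr ?ltr0Sn// mul1r ler_nat.
by rewrite (leq_trans (size_undup r)).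
Qed.

Lemma flat_window_null (w : nat -> flat) (F : seq I * nat) (e : R) :
  (forall i n e, 0 < e ->
     exists t0, forall t, (t0 <= t)%N -> nrm (w t i n) <= e) ->
  0 < e ->
  exists t0, forall t, (t0 <= t)%N -> nrm (flat_restr (window F) (w t)) <= e.
Proof.
move=> wnull e0; case: F => r N.
pose d := e / ((size r).+1%:R * N.+1%:R).
have d0 : 0 < d by rewrite divr_gt0// mulr_gt0 ?ltr0Sn.
have wd i n := wnull i n d d0; have wd2 i := choice (wd i).
pose t i := projT1 (wd2 i); have tP i := projT2 (wd2 i).
exists (\max_(i <- r) \max_(n < N) t i n)%N => t0 tt0.
apply: le_trans (nrm_lp_fin (r := r) _) _ => [i ir|].
  by apply: lp_sumP => n; rewrite flat_restrE /window/= (negPf ir).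
apply: le_trans (_ : \sum_(i <- undup r) (d * N%:R) <= _).
  rewrite big_seq_cond [leRHS]big_seq_cond; apply: ler_sum => i.
  rewrite andbT mem_undup => ir.
  apply: le_trans (nrm_lp_fin (r := iota 0 N) _) _ => [n|].
    by rewrite mem_iota add0n leq0n andTb => /negPf nN; rewrite flat_restrE /window/= nN andbF.
  rewrite undup_id ?iota_uniq//.
  apply: le_trans (_ : \sum_(n <- iota 0 N) d <= _).
    rewrite big_seq_cond [leRHS]big_seq_cond; apply: ler_sum => n.
    rewrite andbT mem_iota add0n leq0n andTb => nN; rewrite flat_restrE /window/= nN ir/=.
    apply: tP; apply: leq_trans tt0.
    apply: leq_trans (@leq_bigmax_seq _ r xpredT (fun i => \max_(n < N) t i n)%N i ir isT).
    exact: (@leq_bigmax_cond _ xpredT (fun n : 'I_N => t i n) (Ordinal nN) isT).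
  by rewrite big_const_seq count_predT size_iota iter_addr_0 -[leLHS]mulr_natr.
rewrite big_const_seq count_predT iter_addr_0 -[leLHS]mulr_natr.
rewrite /d.
have -> : e / ((size r).+1%:R * N.+1%:R) * N%:R * (size (undup r))%:R =
  e * ((N%:R / N.+1%:R) * ((size (undup r))%:R / (size r).+1%:R)).
  by rewrite invfM; ring.
rewrite ler_piMr ?(ltW e0)// mulr_ile1 ?divr_ge0//.
  by rewrite ler_pdivrMr ?ltr0Sn// mul1r ler_nat.
rewrite ler_pdivrMr ?ltr0Sn// mul1r ler_nat.
by rewrite (leq_trans (size_undup r)).
Qed.

(** Each new index is taken so far out that its term is below [e / 2] on the current window, which
    is then enlarged until the tail of that term is below [e / 2]. A fixed error [e] per term
    suffices, because only a number of terms known beforehand is ever summed. *)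
Lemma gliding_hump (w : nat -> flat) (Q : nat -> Prop) (e : R) : 0 < e ->
  (forall i n e, 0 < e ->
     exists t0, forall t, (t0 <= t)%N -> nrm (w t i n) <= e) ->
  (forall t0, exists t, (t0 <= t)%N /\ Q t) ->
  exists (ts : nat -> nat) (u : nat -> flat), [/\
    forall l, (ts l < ts l.+1)%N,
    forall l, Q (ts l),
    forall l, nrm (w (ts l) - u l) <= e,
    forall l l' i n, l != l' -> u l i n = 0 \/ u l' i n = 0 &
    forall l i, nrm (u l i) <= nrm (w (ts l) i)].
Proof.
move=> e0 wnull Qinf; have e20 : 0 < e / 2 by rewrite divr_gt0.
have step (x : nat * (seq I * nat)) : exists y : nat * (seq I * nat),
    [/\ (x.1 < y.1)%N, Q y.1, subwindow x.2 y.2,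
      nrm (flat_restr (window x.2) (w y.1)) <= e / 2 &
      nrm (w y.1 - flat_restr (window y.2) (w y.1)) <= e / 2].
  have [t0 t0P] := flat_window_null x.2 wnull e20.
  have [t [tt0 Qt]] := Qinf (maxn t0 x.1.+1).
  move: tt0; rewrite geq_max => /andP[tt0 xt].
  have [F [xF FP]] := flat_tail (w t) x.2 e20.
  by exists (t, F); split; [exact: xt|exact: Qt|exact: xF|exact: t0P|exact: FP].
have [nxt nxtP] := choice step.
pose st l := iter l nxt (0%N, ([::], 0%N)).
have mono l l' : (l <= l')%N -> subwindow (st l).2 (st l').2.
  elim: l' => [|l' IH]; first by rewrite leqn0 => /eqP ->; split.
  rewrite leq_eqVlt => /predU1P[->|]; first by split.
  rewrite ltnS => /IH[IH1 IH2]; have [_ _ [s1 s2] _ _] := nxtP (st l').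
  by split; [move=> i /IH1 /s1|exact: leq_trans s2].
(* The block [u l] is the part of the term lying in the new window and outside the old one, so
   distinct blocks have disjoint supports. *)
exists (fun l => (st l.+1).1), (fun l => flat_restr (fun i n =>
  window (st l.+1).2 i n && ~~ window (st l).2 i n) (w (st l.+1).1)); split.
- by move=> l; have [] := nxtP (st l.+1).
- by move=> l; have [] := nxtP (st l).
- move=> l; have [_ _ sub r1 r2] := nxtP (st l).
  rewrite (splitr e); apply: le_trans (lerD r2 r1).
  apply: le_trans (ler_nrmD _ _); rewrite le_eqVlt; apply/orP; left.
  apply/eqP; congr nrm; apply: flatP => i n.
  rewrite !flat_addE !flat_oppE !flat_restrE.
  have := subwindowP (i := i) (n := n) sub; rewrite -/(st l.+1).
  case: (window (st l).2 i n) => [->//|_]; rewrite ?addr0 ?subr0 ?subrK//=.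
  by rewrite andbT.
- move=> l l' i n; rewrite !flat_restrE neq_ltn => /orP[] ll'.
    case: (boolP (window (st l.+1).2 i n)) => [h|_]; last by left.
    right; have -> := subwindowP (mono _ _ ll') h; by rewrite andbF.
  case: (boolP (window (st l'.+1).2 i n)) => [h|_]; last by right.
  left; have -> := subwindowP (mono _ _ ll') h; by rewrite andbF.
- move=> l i; apply: nrm_lp_dom1 => n; rewrite flat_restrE.
  by case: ifP; rewrite ?nrm0 ?nrm_ge0.
Qed.

End flat.

Lemma ler_powR_inv (R : realType) (a b t : R) : 0 < t -> 0 <= a -> 0 <= b ->
  a `^ t <= b `^ t -> a <= b.
Proof.
move=> t0 a0 b0; apply: contraTT; rewrite -!ltNge => ba.
by rewrite gt0_ltr_powR ?nnegrE.
Qed.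

Lemma le_eq_trans d (T : porderType d) (x y z : T) :
  (x <= y)%O -> y = z -> (x <= z)%O.
Proof. by move=> xy <-. Qed.

Lemma powR_invK (R : realType) (x t : R) : 0 <= x -> t != 0 ->
  (x `^ t^-1) `^ t = x.
Proof. by move=> x0 t0; rewrite -powRrM mulVf// powRr1. Qed.

(** * Upper and lower estimates for sums of disjoint vectors *)

Section flat_estimates.
Context {R : realType} (p : exponent R) {I : choiceType} (s : I -> exponent R).
Local Notation flat := (flat p s).

Lemma nrm_flat_disjoint (M : nat) (u : nat -> flat) i :
  (forall l l' i n, l != l' -> u l i n = 0 \/ u l' i n = 0) ->
  nrm (\sum_(l < M) u l i) `^ s i = \sum_(l < M) nrm (u l i) `^ s i.
Proof.
by move=> du; apply: (@nrm_lp_disjoint _ _ _ _ M (fun l => u l i)) => l l' n; exact: du.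
Qed.

Lemma nrm_flat_disjoint_le (M : nat) (u : nat -> flat) i (c : R) : 0 <= c ->
  (forall l l' i n, l != l' -> u l i n = 0 \/ u l' i n = 0) ->
  (forall l, nrm (u l i) <= c) ->
  nrm (\sum_(l < M) u l i) <= M%:R `^ (s i : R)^-1 * c.
Proof.
move=> c0 du uc; apply: (@ler_powR_inv _ _ _ (s i)) => //.
- exact: nrm_ge0.
- by rewrite mulr_ge0 ?powR_ge0.
rewrite nrm_flat_disjoint// powRM ?powR_ge0// powR_invK//.
apply: le_trans (_ : \sum_(l < M) c `^ s i <= _); last first.
  by rewrite sumr_const card_ord -[leLHS]mulr_natl.
apply: ler_sum => l _; apply: ge0_ler_powR; rewrite ?nnegrE ?nrm_ge0//.
exact: ltW.
Qed.

(** A lower [r]-estimate. In the summand [i] the norms add in power [s i]; the power mean inequality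
    with [t = s i / p] turns this into [sum_l |u_l i|^p <= M^(1 - p / r) |U i|^p], as [s i <= r].
    Summing over [i] gives [M c^p <= M^(1 - p / r) |U|^p]. *)
Lemma flat_lower (D : pred I) (r : R) (M : nat) (u : nat -> flat) (c : R) :
  0 <= c -> (0 < M)%N -> (p : R) <= r ->
  (forall l l' i n, l != l' -> u l i n = 0 \/ u l' i n = 0) ->
  (forall i, D i -> (p : R) <= (s i : R) <= r) ->
  (forall l i, ~~ D i -> u l i = 0) ->
  (forall l, c <= nrm (u l)) ->
  M%:R `^ r^-1 * c <= nrm (\sum_(l < M) u l).
Proof.
move=> c0 M0 pr du Dr uD cu.
have p0 := exponent_gt0 p; have r0 : 0 < r by exact: lt_le_trans pr.
move UE : (\sum_(l < M) u l) => U.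
have Ui i : U i = \sum_(l < M) u l i by rewrite -UE lp_sum_sumE.
have M1 : 1 <= M%:R :> R by rewrite ler1n.
have Mgt0 : 0 < M%:R :> R by rewrite ltr0n.
pose K : R := M%:R `^ ((p : R) / r - 1).
have K0 : 0 < K by rewrite powR_gt0.
have pw i : \sum_(l < M) nrm (u l i) `^ p <=
    K^-1 * nrm (U i) `^ p.
  have [Di|nDi] := boolP (D i); last first.
    rewrite big1 ?mulr_ge0 ?powR_ge0 ?invr_ge0 ?(ltW K0)// => l _.
    by rewrite uD ?nrm0 ?powR0.
  have /andP[ps sr] := Dr i Di; have s0 := exponent_gt0 (s i).
  set Y := nrm (U i); have Y0 : 0 <= Y by exact: nrm_ge0.
  pose t : R := (s i : R) / (p : R).
  have pt : (p : R) * t = (s i : R) by rewrite /t mulrC divfK// gt_eqF.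
  have t1 : 1 <= t by rewrite ler_pdivlMr// mul1r.
  have t0 : 0 < t by exact: lt_le_trans t1.
  set S := \sum_(l < M) _.
  have SY : S `^ t <= M%:R `^ (t - 1) * Y `^ s i.
    have h := @powR_sum_le R M (fun l => nrm (u l i) `^ p) t t1.
    apply: le_trans (h (fun l => powR_ge0 _ _)) _.
    have := @nrm_flat_disjoint M u i du; rewrite -Ui => h2.
    apply: ler_wpM2l; first exact: powR_ge0.
    refine (le_eq_trans _ (esym h2)); apply: ler_sum => l _.
    by rewrite -powRrM pt.
  have S0 : 0 <= S by apply: sumr_ge0 => l _; exact: powR_ge0.
  rewrite -ler_pdivrMl ?invr_gt0// invrK.
  apply: (@ler_powR_inv _ _ _ t) => //; rewrite ?mulr_ge0 ?powR_ge0 ?(ltW K0)//.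
  rewrite powRM ?(ltW K0)//.
  have -> : (Y `^ p) `^ t = Y `^ s i.
    by rewrite -powRrM pt.
  apply: le_trans (ler_wpM2l (powR_ge0 _ _) SY) _.
  rewrite mulrA ler_piMl ?powR_ge0// -powRrM -powRD; last first.
    by rewrite (gt_eqF Mgt0) implybT.
  rewrite -[leRHS](powRr0 M%:R) ler_powR//.
  have -> : ((p : R) / r - 1) * t + (t - 1) = (s i : R) / r - 1.
    by rewrite /t; field; rewrite !gt_eqF.
  by rewrite subr_le0 ler_pdivrMr// mul1r.
have : (\sum_(l < M) (nrm (u l) `^ p)%:E <=
    (K^-1 * nrm U `^ p)%:E)%E.
  rewrite EFinM -(lp_massE U).
  rewrite lp_mass_esum; apply: le_trans (le_esumZ _ _); last 2 first.
  - by rewrite invr_ge0 ltW.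
  - by move=> i; rewrite lee_fin powR_ge0.
  rewrite (eq_bigr (fun l : 'I_M => lp_mass p (u l))); last first.
    by move=> l _; rewrite -lp_massE.
  rewrite (eq_bigr _ (fun l _ => lp_mass_esum p (u (nat_of_ord l)))).
  rewrite -esum_sum//; last by move=> i l _ _; rewrite lee_fin powR_ge0.
  by apply: le_esum => i _; rewrite sumEFin -EFinM lee_fin.
rewrite sumEFin lee_fin => le1.
apply: (@ler_powR_inv _ _ _ p) => //; rewrite ?mulr_ge0 ?powR_ge0 ?nrm_ge0//.
rewrite powRM ?powR_ge0// -powRrM.
have -> : M%:R `^ (r^-1 * (p : R)) = K * M%:R.
  rewrite /K -{3}[M%:R]powRr1 ?(ltW Mgt0)// -powRD ?subrK 1?mulrC//.
  by rewrite (gt_eqF Mgt0) implybT.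
rewrite -mulrA -ler_pdivlMl//; apply: le_trans le1.
apply: le_trans (_ : \sum_(l < M) c `^ p <= _).
  by rewrite sumr_const card_ord -[leRHS]mulr_natl.
apply: ler_sum => l _; apply: ge0_ler_powR; rewrite ?nnegrE ?nrm_ge0//.
exact: ltW.
Qed.

(* Otherwise a gliding hump extracts from the large terms almost disjoint
   blocks, whose sum is too long by the lower [r]-estimate. *)
Lemma flat_eventually_small (w : nat -> flat) (D : pred I) (r c B : R)
    (M : nat) :
  (forall i n e, 0 < e ->
     exists t0, forall t, (t0 <= t)%N -> nrm (w t i n) <= e) ->
  (p : R) <= r -> (forall i, D i -> (p : R) <= (s i : R) <= r) -> (0 < M)%N ->
  (forall ts : nat -> nat, (forall l, (ts l < ts l.+1)%N) ->
     nrm (\sum_(l < M) w (ts l)) <= B) ->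
  B < M%:R `^ r^-1 * c ->
  exists t0, forall t, (t0 <= t)%N -> nrm (lp_restr D (w t)) < c.
Proof.
move=> wnull pr Dr M0 wB Bc.
have [//|no] := pselect (exists t0, forall t, (t0 <= t)%N ->
  nrm (lp_restr D (w t)) < c).
exfalso.
have B0 : 0 <= B by apply: le_trans (wB id _) => //; exact: nrm_ge0.
have Qinf t0 : exists t, (t0 <= t)%N /\ c <= nrm (lp_restr D (w t)).
  apply: contrapT => nt; apply: no; exists t0 => t tt0.
  by rewrite ltNge; apply/negP => ct; apply: nt; exists t.
set m := M%:R `^ r^-1 in Bc.
have Mgt0 : 0 < M%:R :> R by rewrite ltr0n.
have m0 : 0 < m by rewrite powR_gt0.
have c0 : 0 < c by rewrite -(pmulr_rgt0 _ m0) (le_lt_trans B0).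
(* Replacing terms by blocks costs [M e] in the upper bound and [m e] in the lower one; this [e]
   makes both together half of the gap [m c - B]. *)
pose e := (m * c - B) / (2 * (m + M%:R)).
have mM0 : 0 < m + M%:R by rewrite addr_gt0.
have e0 : 0 < e by rewrite divr_gt0 ?subr_gt0// mulr_gt0.
have eE : e * (m + M%:R) = (m * c - B) / 2.
  by rewrite /e; field; rewrite gt_eqF.
have [ts [u [tsl Qts wu du _]]] := gliding_hump e0 wnull Qinf.
have ec : 0 <= c - e.
  rewrite subr_ge0 -(ler_pM2r mM0) eE.
  have : 0 <= c * M%:R by rewrite mulr_ge0 ?ltW.
  by have := mulr_gt0 c0 m0; rewrite mulrC; lra.
pose v l := lp_restr D (u l).
have dv l l' i n : l != l' -> v l i n = 0 \/ v l' i n = 0.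
  move=> ll'; rewrite !lp_restrE; case: (D i); last by left.
  exact: du.
have vc l : c - e <= nrm (v l).
  rewrite lerBlDr; apply: le_trans (Qts l) _.
  rewrite -lerBlDl; apply: le_trans (ler_distB_nrm _ _) _.
  rewrite /v -lp_restrB; apply: le_trans (nrm_lp_restr _ _) _; exact: wu.
have vD l i : ~~ D i -> v l i = 0 by move=> /negPf Di; rewrite lp_restrE Di.
have := flat_lower ec M0 pr dv Dr vD vc.
rewrite leNgt => /negP; apply.
have -> : \sum_(l < M) v l = lp_restr D (\sum_(l < M) u l).
  by rewrite lp_restr_sum.
apply: le_lt_trans (nrm_lp_restr _ _) _.
have -> : \sum_(l < M) u l =
    \sum_(l < M) w (ts l) - \sum_(l < M) (w (ts l) - u l).
  rewrite -sumrB; apply: eq_bigr => l _.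
  by rewrite opprB addrCA subrr addr0.
apply: le_lt_trans (ler_nrmB _ _) _.
apply: le_lt_trans (lerD (wB ts tsl) (_ : _ <= e * M%:R)) _.
  apply: le_trans (ler_nrm_sum _ _ _) _.
  apply: le_trans (_ : \sum_(l < M) e <= _).
    by apply: ler_sum => l _; exact: wu.
  by rewrite sumr_const card_ord -[leLHS]mulr_natr.
rewrite -/m mulrBr ltrBrDr -addrA (mulrC m e) -mulrDr (addrC M%:R) eE.
by lra.
Qed.

End flat_estimates.

(** * The components of X *)

(** Balls here have radii in [R[i]]; this reads closedness with real radii. *)
Lemma closed_nrm (R : realType) (V : normedModType R[i]) (W : set V) :
  (forall z, (forall e : R, 0 < e -> exists w, W w /\ nrm (z - w) < e) -> W z)
  <-> closed W.
Proof.
split=> [clW z zW|clW z zW].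
  apply: clW => e e0; have e0C : 0 < (e%:C%C : R[i]) by rewrite ltcR.
  have [w [Ww]] := zW _ (nbhsx_ballx z _ e0C).
  rewrite -ball_normE/= => zw; exists w; split => //.
  by rewrite -ltcR nrmE -rnormE.
apply: clW => B /nbhs_ballP[d/= d0 dB].
have dE : d = (complex.Re d)%:C%C.
  by rewrite RRe_real// realE ltW.
have d0' : 0 < complex.Re d by rewrite -ltcR -dE.
have [w [Ww zw]] := zW _ d0'; exists w; split => //; apply: dB.
by rewrite -ball_normE/= rnormE dE ltcR -nrmE.
Qed.

Section component.
Context {R : realType} (p : exponent R) (k : nat) (e : nat -> exponent R).

(** Coordinates of [a x_t + b y_t] along [f_{1,t}, ..., f_{5,t}]. Up to the weights, the linear
    forms that occur are [a], [b], [a + b] and [a + i b], whose kernels are the four lines of the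
    argument. *)
Definition ell5_coef (a b : R[i]) (j : nat) : R[i] :=
  nth 0 [:: a; b; (gamma k e 2)%:C%C * a; (gamma k e 8)%:C%C * (a + b);
    (gamma k e 24)%:C%C * (a + 'i%C * b)] j.

Lemma ell5_coefD a b a' b' j :
  ell5_coef (a + a') (b + b') j = ell5_coef a b j + ell5_coef a' b' j.
Proof.
by case: j => [|[|[|[|[|j]]]]]; rewrite /ell5_coef/= ?nth_nil ?addr0//; ring.
Qed.

Lemma ell5_coefZ c a b j : ell5_coef (c * a) (c * b) j = c * ell5_coef a b j.
Proof.
by case: j => [|[|[|[|[|j]]]]]; rewrite /ell5_coef/= ?nth_nil ?mulr0//; ring.
Qed.

Lemma ell5_coef0 j : ell5_coef 0 0 j = 0.
Proof. by have := ell5_coefZ 0 0 0 j; rewrite !mul0r. Qed.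

Definition idx0 : 'I_5 := @Ordinal 5 0 isT.
Definition idx1 : 'I_5 := @Ordinal 5 1 isT.
Definition idx2 : 'I_5 := @Ordinal 5 2 isT.
Definition idx3 : 'I_5 := @Ordinal 5 3 isT.
Definition idx4 : 'I_5 := @Ordinal 5 4 isT.

Lemma ord5_ind (Q : 'I_5 -> Prop) : Q idx0 -> Q idx1 -> Q idx2 -> Q idx3 -> Q idx4 ->
  forall j, Q j.
Proof.
move=> q0 q1 q2 q3 q4 [[|[|[|[|[|j]]]]] jlt]//.
- by rewrite (_ : Ordinal _ = idx0)//; apply: val_inj.
- by rewrite (_ : Ordinal _ = idx1)//; apply: val_inj.
- by rewrite (_ : Ordinal _ = idx2)//; apply: val_inj.
- by rewrite (_ : Ordinal _ = idx3)//; apply: val_inj.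
- by rewrite (_ : Ordinal _ = idx4)//; apply: val_inj.
Qed.

Lemma fvecE j (hj : (j.-1 < 5)%N) t (i : 'I_5) n :
  fvec p e hj t i n = ((i == j.-1 :> nat) && (n == t))%:R :> R[i].
Proof.
rewrite /fvec/=; have [->|ij] := eqVneq i (Ordinal hj); last first.
  rewrite dfwithout; last by rewrite eq_sym.
  move: ij; rewrite -val_eqE/= => /negPf ->.
  by [].
rewrite dfwithin eqxx/=; have [->|nt] := eqVneq n t; first by rewrite dfwithin.
by rewrite dfwithout// eq_sym.
Qed.

Definition pairvec (a b : R[i]) (t : nat) : ell5 p e :=
  a *: xvec p k e t + b *: yvec p k e t.

Lemma pairvecE a b t (j : 'I_5) n :
  pairvec a b t j n = ell5_coef a b j * (n == t)%:R.
Proof.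
rewrite /pairvec !flat_addE.
have Zflat c (f : ell5 p e) i m : (c *: f) i m = c * f i m by [].
rewrite !Zflat /xvec /yvec !flat_addE !Zflat !fvecE.
by elim/ord5_ind : j; rewrite /ell5_coef/=; case: (n == t);
  rewrite /= ?mulr1 ?mulr0 ?addr0 ?add0r//; ring.
Qed.

(** The concrete description of [X_{k,m}]: at each place [n] the first two coordinates determine the
    other three. *)
Definition component_set : set (ell5 p e) :=
  [set z : ell5 p e | forall (j : 'I_5) n, z j n = ell5_coef (z idx0 n) (z idx1 n) j].

Lemma component_set_closed : closed_subspace component_set.
Proof.
split.
- apply/closed_nrm => z zW j n; apply/eqP; rewrite -subr_eq0; apply/eqP.
  set d := z j n - _.
  have [//|dn0] := eqVneq d 0; exfalso.
  have nd : 0 < nrm d.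
    rewrite lt_neqAle nrm_ge0 andbT eq_sym; apply: contra dn0 => /eqP d0.
    by apply/eqP/rnorm_eq0; rewrite -nrmE.
  (* The defect [d] is a linear functional of [z] that vanishes on the set and is bounded by [B];
     hence it cannot exceed [B] times the distance from [z] to a point [w] of the set. *)
  pose B := 1 + nrm (ell5_coef 1 0 j) + nrm (ell5_coef 0 1 j).
  have B0 : 0 < B by rewrite /B -addrA ltr_pwDl// addr_ge0// nrm_ge0.
  have [w [Ww zw]] := zW (nrm d / B) (divr_gt0 nd B0).
  have : nrm d <= nrm (z - w) * B; last first.
    by rewrite leNgt -ltr_pdivlMr// zw.
  have -> : d = (z - w) j n - (z - w) idx0 n * ell5_coef 1 0 j -
      (z - w) idx1 n * ell5_coef 0 1 j.
    have cE a b : ell5_coef a b j = a * ell5_coef 1 0 j + b * ell5_coef 0 1 j.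
      by rewrite -!ell5_coefZ -ell5_coefD !mulr1 !mulr0 addr0 add0r.
    rewrite !flat_addE !flat_oppE (Ww j n) /d (cE (w idx0 n)) (cE (z idx0 n)).
    by ring.
  rewrite /B !mulrDr mulr1.
  apply: le_trans (ler_nrmB _ _) (lerD (le_trans (ler_nrmB _ _) (lerD _ _)) _).
  - exact: nrm_flat_coord.
  - by rewrite nrmM ler_wpM2r ?nrm_ge0// nrm_flat_coord.
  - by rewrite nrmM ler_wpM2r ?nrm_ge0// nrm_flat_coord.
- by move=> j n; rewrite ell5_coef0.
- by move=> a u v uW vW j n; rewrite !flat_addE /= (uW j n) (vW j n)
    ell5_coefD ell5_coefZ.
Qed.

Lemma pairvec_set a b t : component_set (pairvec a b t).
Proof.
move=> j n; rewrite !pairvecE {2}/ell5_coef {2}/ell5_coef/=.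
by rewrite mulrC -ell5_coefZ !(mulrC _%:R).
Qed.

(** One inclusion is closedness of the set. For the other, truncating [z] to the places [n < N]
    gives a finite combination of the generators, and these truncations approximate [z]. *)
Lemma component_setP (z : ell5 p e) :
  z \in closed_span_pred (range (xvec p k e) `|` range (yvec p k e)) <->
  component_set z.
Proof.
split=> [/set_mem zW|zW].
  apply: zW; split; first exact: component_set_closed.
  move=> _ [[t _ <-]|[t _ <-]].
    by have := pairvec_set 1 0 t; rewrite /pairvec scale1r scale0r addr0.
  by have := pairvec_set 0 1 t; rewrite /pairvec scale1r scale0r add0r.
apply/mem_set => W [[clW W0 WD] WS]; move/closed_nrm : clW; apply => d d0.
have d20 : 0 < d / 2 by rewrite divr_gt0.
have [[r N] [[/= r5 _] zN]] := @flat_tail _ p _ (fun j : 'I_5 => e j.+1) z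
  (d / 2) (enum 'I_5, 0%N) d20.
exists (\sum_(t < N) pairvec (z idx0 t) (z idx1 t) t); split.
  elim/big_ind : _ => // [x y Wx Wy|t _].
    by have := WD 1 x y Wx Wy; rewrite scale1r.
  have Wxy a b u v : W u -> W v -> W (a *: u + b *: v).
    by move=> Wu Wv; apply: (WD a) => //; rewrite -[_ *: v]addr0; exact: (WD b).
  by apply: Wxy; apply: WS; [left|right]; exists t.
have -> : \sum_(t < N) pairvec (z idx0 t) (z idx1 t) t =
    flat_restr (window (r, N)) z.
  apply: (@flatP _ p _ (fun j : 'I_5 => e j.+1)) => j n.
  rewrite (@flat_sumE _ p _ (fun j : 'I_5 => e j.+1)) flat_restrE.
  have -> : window (r, N) j n = (n < N)%N by rewrite /window/= r5 ?mem_enum.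
  rewrite (eq_bigr _ (fun t _ => pairvecE _ _ _ j n)).
  case: ltnP => nN.
    rewrite (bigD1 (Ordinal nN))//= eqxx mulr1 -zW big1 ?addr0// => t.
    by rewrite -val_eqE/= => tn; rewrite eq_sym (negPf tn) mulr0.
  rewrite big1// => t _; rewrite gtn_eqF ?mulr0//.
  exact: leq_trans (ltn_ord t) nN.
apply: le_lt_trans zN _.
by rewrite ltr_pdivrMr// mulr_natr mulr2n ltrDl.
Qed.

Local Notation Z := (X_component p k e).

Definition zc (z : Z) (j : 'I_5) (n : nat) : R[i] := (val z : ell5 p e) j n.

Lemma zcE (z : Z) j n : zc z j n = ell5_coef (zc z idx0 n) (zc z idx1 n) j.
Proof. by have /component_setP := valP z; apply. Qed.

Lemma zcP (z z' : Z) : (forall n, zc z idx0 n = zc z' idx0 n) ->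
  (forall n, zc z idx1 n = zc z' idx1 n) -> z = z'.
Proof.
move=> h0 h1; apply: val_inj; apply: (@flatP _ p _ (fun j : 'I_5 => e j.+1)).
by move=> j n; rewrite -!/(zc _ _ _) zcE h0 h1 -zcE.
Qed.

Lemma nrm_component (z : Z) : nrm z = nrm (val z : ell5 p e).
Proof. by rewrite !nrmE. Qed.

End component.

(** * The parameter w and the weights as its powers *)

Lemma powR_superadd1 (R : realType) (x t : R) : 0 <= x -> 1 <= t ->
  x `^ t + 1 <= (x + 1) `^ t.
Proof.
move=> x0 t1; have t10 : 0 <= t - 1 by rewrite subr_ge0.
have x10 : 0 <= x + 1 by rewrite addr_ge0.
have tE y : 0 <= y -> y `^ t = y * y `^ (t - 1).
  move=> y0; rewrite -{2}(powRr1 y0) -powRD ?subrKC//.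
  by rewrite (gt_eqF (lt_le_trans ltr01 t1)).
rewrite !tE// mulrDl mul1r lerD//; last by rewrite powR_expand// lerDr.
by rewrite ler_wpM2l// ge0_ler_powR ?nnegrE// lerDl.
Qed.

Section gammas.
Context {R : realType} (k : nat) (e : nat -> exponent R).
Hypothesis eta0 : 0 < eta_km e.

Definition omega : R := (N_km k e)%:R `^ eta_km e.

Lemma N_km_gt0 : (0 < N_km k e)%N.
Proof.
rewrite /N_km truncn_gt0 powR_expand ?ler1n//.
by rewrite invr_ge0 ltW.
Qed.

Lemma omega_ge1 : 1 <= omega.
Proof. by rewrite /omega powR_expand ?ler1n ?N_km_gt0// ltW. Qed.

Lemma omega_gt0 : 0 < omega.
Proof. exact: lt_le_trans omega_ge1. Qed.

Lemma omega_le : omega <= k.+1%:R.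
Proof.
have -> : k.+1%:R = (k.+1%:R `^ (eta_km e)^-1) `^ eta_km e :> R.
  by rewrite powR_invK// gt_eqF.
rewrite /omega ge0_ler_powR ?nnegrE ?powR_ge0 ?(ltW eta0)//.
by rewrite /N_km truncn_le powR_ge0.
Qed.

Lemma omega_ge : eta_km e <= 1 -> k%:R <= omega.
Proof.
move=> eta1.
have -> : k%:R = (k%:R `^ (eta_km e)^-1) `^ eta_km e :> R.
  by rewrite powR_invK// gt_eqF.
rewrite /omega ge0_ler_powR ?nnegrE ?powR_ge0 ?(ltW eta0)//.
have /andP[_] := truncn_itv (powR_ge0 (k.+1%:R : R) (eta_km e)^-1).
rewrite -/(N_km k e) -(natr1 (N_km k e)) -(natr1 k) => h.
rewrite -(lerD2r 1); apply/ltW; apply: le_lt_trans h.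
by apply: powR_superadd1 => //; rewrite invf_ge1.
Qed.

Lemma gammaE (n : nat) : gamma k e n%:R = (omega ^+ n)^-1.
Proof.
by rewrite /gamma powRN mulrC powRrM powR_mulrn// powR_ge0.
Qed.

Lemma gamma_gt0 (n : nat) : 0 < gamma k e n%:R.
Proof. by rewrite gammaE invr_gt0 exprn_gt0// omega_gt0. Qed.

Lemma gamma_le1 (n : nat) : gamma k e n%:R <= 1.
Proof. by rewrite gammaE invf_le1 ?exprn_gt0 ?omega_gt0// exprn_ege1// omega_ge1. Qed.

End gammas.

(** * An antilinear conjugation of bounded norm on a component *)

Section component_conj.
Context {R : realType} (p : exponent R) (k : nat) (e : nat -> exponent R).
Hypothesis eta0 : 0 < eta_km e.
Hypothesis edecr : forall j, (0 < j < 5)%N -> (e j.+1 : R) <= (e j : R).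
Local Notation Z := (X_component p k e).
Local Notation G := (omega k e ^+ 24).

Let seqsp (s : exponent R) := lp_sum s (fun _ : nat => R[i]^o).

Let absl_le (s : exponent R) (i : nat) (x : R[i]^o) :
  nrm ((nrm x)%:C%C : R[i]^o) <= 1 * nrm x.
Proof. by rewrite mul1r nrmC ger0_norm ?nrm_ge0. Qed.

Let absl s (f : seqsp s) : seqsp s := lp_map (p := s) ler01 (@absl_le s) f.

(** Conjugating [a + b] and [a + i b] preserves moduli in the last two coordinates. The new [a] and
    [b] are combinations of these two conjugates, with a factor at most [G] for undoing the weights,
    and they lie in the first spaces because [l_{p_5}] and [l_{p_4}] are contained in [l_{p_j}] for
    smaller [j]. Each of the five coordinates costs at most [4 G]. *)
Lemma component_conj_exists (z : Z) : exists w : Z,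
  [/\ forall n, zc w idx3 n = ((zc z idx3 n)^*)%C,
      forall n, zc w idx4 n = ((zc z idx4 n)^*)%C &
      nrm w <= 20 * G * nrm z].
Proof.
pose g8 : R[i] := (gamma k e 8)%:C%C; pose g24 : R[i] := (gamma k e 24)%:C%C.
have g8g : g8 != 0 by rewrite eq_complex/= eqxx andbT gt_eqF// (gamma_gt0 k eta0 8).
have g24g : g24 != 0 by rewrite eq_complex/= eqxx andbT gt_eqF// (gamma_gt0 k eta0 24).
(* [h] inverts [1 - i], hence [b = (S - L) h] and [a = S - b] solve [a + b = S], [a + i b = L]. *)
pose h : R[i] := (1 + 'i%C) / 2%:R.
have ii : 'i%C * 'i%C = -1 :> R[i] by rewrite -expr2 sqr_i.
have hE : h * (1 - 'i%C) = 1.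
  have -> : h * (1 - 'i%C) = (1 - 'i%C * 'i%C) / 2%:R by rewrite /h; ring.
  by rewrite ii opprK divff// pnatr_eq0.
have nh : nrm h <= 1.
  rewrite /h nrmM nrmV.
  have -> : nrm (2%:R : R[i]) = 2 by rewrite -(rmorph_nat (real_complex R)) nrmC normr_nat.
  by rewrite ler_pdivrMr// mul1r (le_trans (ler_nrmD _ _))// nrm1 nrmi.
pose S n : R[i] := g8^-1 * ((zc z idx3 n)^*)%C.
pose L n : R[i] := g24^-1 * ((zc z idx4 n)^*)%C.
pose b n := (S n - L n) * h; pose a n := S n - b n.
pose u n := nrm (zc z idx3 n); pose v n := nrm (zc z idx4 n).
have G1 : 1 <= G by rewrite exprn_ege1// omega_ge1.
have Sn n : nrm (S n) <= G * u n.
  rewrite nrmM nrm_conjc ler_wpM2r ?nrm_ge0// nrmV nrmC gammaE ger0_norm.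
    by rewrite invrK ler_weXn2l// omega_ge1.
  by rewrite invr_ge0 exprn_ge0// ltW// omega_gt0.
have Ln n : nrm (L n) <= G * v n.
  rewrite nrmM nrm_conjc ler_wpM2r ?nrm_ge0// nrmV nrmC gammaE ger0_norm.
    by rewrite invrK.
  by rewrite invr_ge0 exprn_ge0// ltW// omega_gt0.
have bn n : nrm (b n) <= G * (u n + v n).
  rewrite nrmM; apply: le_trans (ler_piMr _ nh) _; first exact: nrm_ge0.
  by rewrite mulrDr (le_trans (ler_nrmB _ _))// lerD.
have uv0 n : 0 <= u n + v n by rewrite addr_ge0// nrm_ge0.
have G0 : 0 <= G by exact: le_trans G1.
have an n : nrm (a n) <= 2 * G * (u n + v n).
  apply: le_trans (ler_nrmB _ _) _; apply: le_trans (lerD (Sn n) (bn n)) _.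
  rewrite -mulrA [leRHS]mulr_natl mulr2n lerD2r ler_wpM2l// lerDl nrm_ge0//.
have abS n : a n + b n = S n by rewrite subrK.
have abL n : a n + 'i%C * b n = L n.
  rewrite /a -addrA -[- b n + _]opprK opprD opprK -{1}[b n]mul1r -mulrBl.
  by rewrite /b mulrCA (mulrC _ h) hE mulr1 opprB addrC subrK.
have key (j : 'I_5) : exists g : seqsp (e j.+1),
    (forall n, g n = ell5_coef k e (a n) (b n) j) /\ nrm g <= 4 * G * nrm z.
  have e54 (j' : nat) : (0 < j' <= 4)%N -> (e 4 : R) <= (e j' : R).
    have h1 := edecr (j := 1) isT; have h2 := edecr (j := 2) isT.
    have h3 := edecr (j := 3) isT.
    case: j' => [|[|[|[|[|?]]]]]//= _; first exact: le_trans (le_trans h3 h2) h1.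
    by exact: le_trans h3 h2.
  have zi (i : 'I_5) : nrm ((val z : ell5 p e) i) <= nrm z.
    by rewrite nrm_component; exact: nrm_lp_coord.
  have dom (c : R) (s : exponent R) (m : seqsp s) (f : nat -> R[i]^o) : 0 <= c ->
      (forall n, nrm (f n) <= c * nrm (m n)) -> nrm m <= 2 * nrm z ->
      2 * c <= 4 * G ->
      exists g : seqsp s, (forall n, g n = f n) /\ nrm g <= 4 * G * nrm z.
    move=> c0 fm mz cG; exists (LpSum (lp_finite_dom (p := s) (g := m) c0 fm)); split; first by [].
    apply: (@le_trans _ _ (c * nrm m)); first exact: nrm_lp_dom.
    apply: le_trans (ler_wpM2l c0 mz) _.
    by rewrite mulrA ler_wpM2r ?nrm_ge0// mulrC.
  have [j4|j4] := eqVneq j idx4.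
    rewrite j4; apply: (dom 1 _ ((val z : ell5 p e) idx4)) => //.
    - by move=> n; rewrite mul1r /ell5_coef/= abL mulrA divff// mul1r nrm_conjc.
    - by apply: le_trans (zi idx4) _; rewrite ler_peMl ?nrm_ge0// ler1n.
    - by lra.
  have j5 : (j < 4)%N.
    by rewrite ltn_neqAle -ltnS ltn_ord andbT; move: j4; rewrite -val_eqE.
  have j3 : (e 4 : R) <= (e j.+1 : R) by apply: e54.
  have j3' : (e 5 : R) <= (e j.+1 : R) by apply: le_trans j3; exact: edecr.
  (* A majorant with entries [u n + v n], built from the sequences of moduli of the last two
     coordinates, both moved into [l_{p_{j+1}}]. *)
  pose m : seqsp (e j.+1) :=
    LpSum (lp_finite_incl j3 (absl ((val z : ell5 p e) idx3))) +
    LpSum (lp_finite_incl j3' (absl ((val z : ell5 p e) idx4))).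
  have mE n : m n = (u n + v n)%:C%C by rewrite rmorphD.
  have nm n : nrm (m n) = u n + v n by rewrite mE nrmC ger0_norm.
  apply: (dom (2 * G) _ m) => //.
  - by rewrite mulr_ge0.
  - move=> n; rewrite nm.
    have one (y : R[i]) (n1 : nat) : nrm y <= 2 * G * (u n + v n) ->
        nrm ((gamma k e n1%:R)%:C%C * y) <= 2 * G * (u n + v n).
      move=> yn; apply: le_trans yn; rewrite nrmM nrmC ger0_norm ?(ltW (gamma_gt0 k eta0 n1))//.
      by rewrite ler_piMl ?nrm_ge0// gamma_le1.
    have bn' : nrm (b n) <= 2 * G * (u n + v n).
      by apply: le_trans (bn n) _; rewrite -mulrA [leRHS]mulr_natl mulr2n lerDl mulr_ge0.
    move: j5; elim/ord5_ind : j {j4 j3 j3' m mE nm} => //= _; rewrite /ell5_coef/=.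
    + exact: an.
    + exact: (one _ 2%N).
    + apply: (one _ 8%N); rewrite abS; apply: le_trans (Sn n) _.
      rewrite -mulrA [leRHS]mulr_natl mulr2n mulrDr -addrA lerDl addr_ge0//.
        by rewrite mulr_ge0// nrm_ge0.
      by rewrite addr_ge0// mulr_ge0// nrm_ge0.
  - rewrite mulr_natl mulr2n; apply: le_trans (ler_nrmD _ _) _; apply: lerD.
      apply: le_trans (zi idx3); apply: (@le_trans _ _ (nrm (absl ((val z : ell5 p e) idx3)))).
        exact: nrm_lp_incl.
      by rewrite -[leRHS]mul1r; exact: nrm_lp_map.
    apply: le_trans (zi idx4); apply: (@le_trans _ _ (nrm (absl ((val z : ell5 p e) idx4)))).
      exact: nrm_lp_incl.
    by rewrite -[leRHS]mul1r; exact: nrm_lp_map.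
  - by rewrite mulrA -natrM.
have kg (j : 'I_5) := cid (key j).
pose W : ell5 p e := \sum_(j < 5) lp_single p (projT1 (kg j)).
have Wj (j : 'I_5) : W j = projT1 (kg j).
  rewrite /W lp_sum_sumE (bigD1 j)//= dfwithin big1 ?addr0// => i ij.
  by rewrite dfwithout.
have WE (j : 'I_5) n : W j n = ell5_coef k e (a n) (b n) j.
  by rewrite Wj; have [-> _] := projT2 (kg j).
have WZ : component_set k W by move=> j n; rewrite !WE.
exists (ClosedSpan (proj2 (component_setP k W) WZ)); split => [n|n|].
- by rewrite /zc/= WE /ell5_coef/= abS mulrA divff// mul1r.
- by rewrite /zc/= WE /ell5_coef/= abL mulrA divff// mul1r.
- rewrite nrm_component/=; apply: le_trans (ler_nrm_sum _ _ _) _.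
  apply: le_trans (_ : \sum_(j < 5) (4 * G * nrm z) <= _).
    apply: ler_sum => j _; rewrite nrm_lp_single.
    by have [_] := projT2 (kg j).
  by rewrite sumr_const card_ord -[leLHS]mulr_natl !mulrA -natrM.
Qed.
End component_conj.

(** * Sums of copies of one vector a x + b y *)

Section pair_sums.
Context {R : realType} (p : exponent R) (k : nat) (e : nat -> exponent R).
Local Notation Z := (X_component p k e).

Definition zpair a b t : Z :=
  ClosedSpan (proj2 (component_setP k _) (pairvec_set p k e a b t)).

Lemma zc_zpair a b t (j : 'I_5) n :
  zc (zpair a b t) j n = ell5_coef k e a b j * (n == t)%:R.
Proof. exact: pairvecE. Qed.

Lemma zcD (z z' : Z) j n : zc (z + z') j n = zc z j n + zc z' j n.
Proof. by []. Qed.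

Lemma zcZ c (z : Z) j n : zc (c *: z) j n = c * zc z j n.
Proof. by []. Qed.

Lemma zpairD a b a' b' t : zpair (a + a') (b + b') t = zpair a b t + zpair a' b' t.
Proof.
by apply: zcP => n; rewrite zcD !zc_zpair ell5_coefD mulrDl.
Qed.

Lemma zpairZ c a b t : zpair (c * a) (c * b) t = c *: zpair a b t.
Proof.
by apply: zcP => n; rewrite zcZ !zc_zpair ell5_coefZ mulrA.
Qed.

Lemma ltn_ts (ts : nat -> nat) l l' : (forall l, (ts l < ts l.+1)%N) ->
  l != l' -> ts l != ts l'.
Proof.
move=> tsl; have mono m n : (m < n)%N -> (ts m < ts n)%N.
  elim: n => // n IH; rewrite ltnS leq_eqVlt => /predU1P[->//|/IH h].
  exact: ltn_trans (tsl n).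
by rewrite !neq_ltn => /orP[] /mono ->; rewrite ?orbT.
Qed.

Section psum.
Variables (th : nat -> R[i]) (ts : nat -> nat) (M : nat) (a b : R[i]).
Hypothesis th1 : forall l, nrm (th l) = 1.
Hypothesis tsl : forall l, (ts l < ts l.+1)%N.

(** The unimodular factors do not affect norms; they serve to align the signs of a functional on the
    images of the terms. *)
Definition psum : Z := \sum_(l < M) th l *: zpair a b (ts l).

Lemma psum_comp (j : 'I_5) : nrm ((val psum : ell5 p e) j) =
  M%:R `^ (e j.+1 : R)^-1 * nrm (ell5_coef k e a b j).
Proof.
pose u l : ell5 p e := th l *: pairvec p k e a b (ts l).
have uE l (i : 'I_5) n : u l i n = th l * (ell5_coef k e a b i * (n == ts l)%:R).
  by rewrite -(pairvecE p).
have -> : (val psum : ell5 p e) = \sum_(l < M) u l.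
  by rewrite /psum raddf_sum.
rewrite lp_sum_sumE.
have du l l' (i : 'I_5) n : l != l' -> u l i n = 0 \/ u l' i n = 0.
  move=> ll'; rewrite !uE; have [->|] := eqVneq n (ts l).
    by right; rewrite (negPf (ltn_ts tsl ll')) !mulr0.
  by left; rewrite !mulr0.
have un l : nrm (u l j) = nrm (ell5_coef k e a b j).
  rewrite (_ : u l j = lp_single (e j.+1) (V := fun _ : nat => R[i]^o) (i := ts l)
    (th l * ell5_coef k e a b j)).
    by rewrite nrm_lp_single nrmM th1 mul1r.
  apply: lp_sumP => n; rewrite uE /=; have [->|nt] := eqVneq n (ts l).
    by rewrite dfwithin mulr1.
  by rewrite dfwithout ?mulr0// eq_sym.
have := @nrm_flat_disjoint _ p _ (fun j : 'I_5 => e j.+1) M u j du.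
rewrite (eq_bigr (fun=> nrm (ell5_coef k e a b j) `^ e j.+1)); last first.
  by move=> l _; rewrite un.
rewrite sumr_const card_ord -[X in _ = X]mulr_natl => h.
apply: (@powR_injective _ (e j.+1 : R)); rewrite ?nnegrE ?mulr_ge0 ?nrm_ge0 ?powR_ge0//.
by rewrite h powRM ?powR_ge0 ?nrm_ge0// powR_invK.
Qed.

Lemma psum_le : nrm psum <=
  \sum_(j < 5) M%:R `^ (e j.+1 : R)^-1 * nrm (ell5_coef k e a b j).
Proof.
rewrite nrm_component; apply: le_trans (nrm_lp_fin (r := enum 'I_5) _) _ => [i|].
  by rewrite mem_enum.
rewrite undup_id ?enum_uniq// big_enum/=.
by apply: ler_sum => j _; rewrite -psum_comp.
Qed.

Lemma psum_ge (j : 'I_5) :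
  M%:R `^ (e j.+1 : R)^-1 * nrm (ell5_coef k e a b j) <= nrm psum.
Proof. by rewrite -psum_comp nrm_component; exact: nrm_lp_coord. Qed.

End psum.
End pair_sums.

(** * Antilinear maps on a component *)

Lemma infinite_subsequence (Q : nat -> Prop) :
  (forall t0, exists t, (t0 <= t)%N /\ Q t) ->
  exists ts : nat -> nat, (forall l, (ts l < ts l.+1)%N) /\ forall l, Q (ts l).
Proof.
move=> Qinf.
have step x : exists y, (x < y)%N /\ Q y by have [y yP] := Qinf x.+1; exists y.
have [nxt nxtP] := choice step.
exists (fun l => iter l.+1 nxt 0%N); split=> l.
  by have [] := nxtP (iter l.+1 nxt 0%N).
by have [] := nxtP (iter l nxt 0%N).
Qed.

Lemma nrm_lp_fin_seq (R : realType) (p : exponent R) (I : choiceType)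
    (V : I -> normedModType R[i]) (r : seq I) (f : lp_sum p V) :
  (forall i, i \notin r -> f i = 0) -> nrm f <= \sum_(i <- r) nrm (f i).
Proof.
move=> fr; apply: le_trans (nrm_lp_fin fr) _.
elim: r {fr} => //= i r IH; rewrite big_cons; case: ifP => _.
  by rewrite (le_trans IH)// lerDr nrm_ge0.
by rewrite big_cons lerD2l.
Qed.

Lemma sum_ord5 (V : nmodType) (F : 'I_5 -> V) :
  \sum_(j < 5) F j = F idx0 + F idx1 + F idx2 + F idx3 + F idx4.
Proof.
rewrite !big_ord_recr big_ord0/= add0r.
by do ![congr (_ + _)]; congr F; apply: val_inj.
Qed.

Section core.
Context {R : realType} (p : exponent R) (k : nat) (e : nat -> exponent R)
  {I : choiceType} (s : I -> exponent R) (own : 'I_5 -> I).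
Local Notation Z := (X_component p k e).
Local Notation E := (flat p s).
Local Notation w := (omega k e).
Local Notation N := (N_km k e).
Local Notation m := (N%:R `^ (e 1 : R)^-1).

Hypothesis eta0 : 0 < eta_km e.
Hypothesis estep : forall j, (1 <= j < 5)%N ->
  (e j.+1 : R)^-1 - (e j : R)^-1 = eta_km e.
Hypothesis pe : forall j : 'I_5, (p : R) <= (e j.+1 : R).
Hypothesis e5 : 1 < (e 5 : R).
Hypothesis sown : forall j, (s (own j) : R) = (e j.+1 : R).

Variables (T : Z -> E) (C : R).
Hypothesis C1 : 1 <= C.
Hypothesis TD : {morph T : x y / x + y}.
Hypothesis TZ : forall (c : R) x, T (c%:C%C *: x) = (c%:C%C : R[i]) *: T x.
Hypothesis TC : forall x, nrm (T x) <= C * nrm x.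

Let w0 : 0 < w := omega_gt0 k eta0.
Let w1 : 1 <= w := omega_ge1 k eta0.
Let C0 : 0 < C := lt_le_trans ltr01 C1.
Let N0 : 0 < N%:R :> R. Proof. by rewrite ltr0n N_km_gt0. Qed.
Let m0 : 0 < m. Proof. by rewrite powR_gt0. Qed.

Lemma core_einv (j : 'I_5) : (e j.+1 : R)^-1 = (e 1 : R)^-1 + j%:R * eta_km e.
Proof.
have h1 := estep (j := 1) isT; have h2 := estep (j := 2) isT.
have h3 := estep (j := 3) isT; have h4 := estep (j := 4) isT.
elim/ord5_ind : j => /=.
- by rewrite mul0r addr0.
- by rewrite mul1r -h1 addrC subrK.
- by lra.
- by lra.
- by lra.
Qed.

Lemma core_edecr (j j' : 'I_5) : (j <= j')%N -> (e j'.+1 : R) <= (e j.+1 : R).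
Proof.
move=> jj'; rewrite -[leLHS]invrK -[leRHS]invrK.
rewrite lef_pV2 ?posrE ?invr_gt0 ?exponent_gt0// !core_einv lerD2l.
by rewrite ler_wpM2r ?(ltW eta0)// ler_nat.
Qed.

(** The reciprocals of the exponents are in arithmetic progression with step [eta]. So for sums of
    [N ^ u] vectors the five spaces differ only by powers of [w], and every later comparison is one
    of exponents of [w]. *)
Lemma core_powN (u : nat) (j : 'I_5) :
  (N ^ u)%:R `^ (e j.+1 : R)^-1 = m ^+ u * w ^+ (u * j).
Proof.
have N00 : (0 : R) <= N%:R by exact: ltW.
have -> : (N ^ u)%:R = (N%:R : R) `^ u%:R by rewrite powR_mulrn ?natrX.
rewrite -powRrM mulrC powRrM core_einv powRD; last first.
  by rewrite (gt_eqF N0) implybT.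
rewrite (mulrC j%:R) powRrM -/w powR_mulrn; last first.
  by rewrite mulr_ge0 ?powR_ge0.
by rewrite exprMn powR_mulrn ?powR_ge0// -exprM mulnC.
Qed.

Lemma core_T0 : T 0 = 0.
Proof. by apply: (addrI (T 0)); rewrite -TD !addr0. Qed.

Lemma core_TN x : T (- x) = - T x.
Proof. by apply: (addrI (T x)); rewrite -TD !subrr core_T0. Qed.

Lemma core_Tsum (J : Type) (r : seq J) (F : J -> Z) :
  T (\sum_(l <- r) F l) = \sum_(l <- r) T (F l).
Proof.
by elim: r => [|l r IH]; rewrite ?big_nil ?core_T0// !big_cons TD IH.
Qed.

Definition pair_size (a b : R[i]) : R :=
  \sum_(j < 5) nrm (ell5_coef k e a b j).

Lemma psum_le_last th ts M a b : (forall l, nrm (th l) = 1) ->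
  (forall l, (ts l < ts l.+1)%N) -> (0 < M)%N ->
  nrm (psum p k e th ts M a b) <= pair_size a b * M%:R `^ (e 5 : R)^-1.
Proof.
move=> th1 tsl M0; apply: le_trans (psum_le _ _ _ _ _ _ th1 tsl) _.
rewrite /pair_size mulr_suml; apply: ler_sum => j _.
rewrite mulrC ler_wpM2l ?nrm_ge0// ler_powR ?ler1n//.
rewrite (core_einv j) (core_einv idx4) lerD2l ler_wpM2r ?(ltW eta0)// ler_nat.
by rewrite -ltnS.
Qed.

(** [T] is only real-linear, so a complex phase cannot be moved through it; signs can, which is why
    the real and imaginary parts are treated separately. With signs aligning the large values, [M]
    terms give [M d] at most a constant times [M^(1 / p_5)], false for large [M] since [p_5 > 1]. *)
Lemma core_null_real (phi : R[i] -> R) a b : {morph phi : x y / x + y} ->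
  (forall (c : R) x, phi (c%:C%C * x) = c * phi x) ->
  (forall x, `|phi x| <= nrm x) ->
  forall i n (d : R), 0 < d -> exists t0, forall t, (t0 <= t)%N ->
    `|phi (T (zpair p k e a b t) i n)| <= d.
Proof.
move=> phiD phiZ phi1 i n d d0.
have [//|no] := pselect (exists t0, forall t, (t0 <= t)%N ->
    `|phi (T (zpair p k e a b t) i n)| <= d); exfalso.
have phi0 : phi 0 = 0 by apply: (addrI (phi 0)); rewrite -phiD !addr0.
have phis (J : Type) (r : seq J) (F : J -> R[i]) :
    phi (\sum_(l <- r) F l) = \sum_(l <- r) phi (F l).
  by elim: r => [|l r IH]; rewrite ?big_nil ?phi0// !big_cons phiD IH.
have [ts [tsl tsd]] : exists ts : nat -> nat, (forall l, (ts l < ts l.+1)%N) /\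
    forall l, d < `|phi (T (zpair p k e a b (ts l)) i n)|.
  apply: (infinite_subsequence (Q := fun t =>
    d < `|phi (T (zpair p k e a b t) i n)|)) => t0; apply: contrapT => nt; apply: no.
  by exists t0 => t tt0; rewrite leNgt; apply/negP => dt; apply: nt; exists t.
pose g l : R := Num.sg (phi (T (zpair p k e a b (ts l)) i n)).
have g1 l : nrm ((g l)%:C%C : R[i]) = 1.
  have gn : phi (T (zpair p k e a b (ts l)) i n) != 0.
    by rewrite -normr_gt0 (lt_trans d0).
  by rewrite nrmC /g normr_sg gn.
have a0 : 0 < 1 - (e 5 : R)^-1.
  by rewrite subr_gt0 invf_lt1// (lt_trans ltr01).
have [M [M0 BM]] := exists_nat_powR_gt (C * pair_size a b / d) a0.
have MM : 0 < M%:R :> R by rewrite ltr0n.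
have h1 : M%:R * d <= C * (pair_size a b * M%:R `^ (e 5 : R)^-1).
  apply: le_trans (ler_wpM2l (ltW C0)
    (psum_le_last a b g1 tsl M0)).
  apply: le_trans (TC _); apply: le_trans (nrm_flat_coord _ i n).
  apply: le_trans (phi1 _); rewrite core_Tsum flat_sumE phis.
  have -> : \sum_(l < M) phi (T ((g l)%:C%C *: zpair p k e a b (ts l)) i n) =
      \sum_(l < M) `|phi (T (zpair p k e a b (ts l)) i n)|.
    by apply: eq_bigr => l _; rewrite TZ phiZ /g -normrEsg.
  apply: le_trans (ler_norm _).
  apply: le_trans (_ : \sum_(l < M) d <= _).
    by rewrite sumr_const card_ord -[leRHS]mulr_natl.
  by apply: ler_sum => l _; exact: ltW.
move: BM; rewrite ltNge => /negP; apply.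
rewrite ler_pdivlMr// -(ler_pM2r (powR_gt0 (e 5 : R)^-1 MM)).
rewrite mulrAC -powRD; last by rewrite (gt_eqF MM) implybT.
by rewrite subrK powRr1 ?(ltW MM)// -mulrA.
Qed.

(* An image of the unit vector basis that stayed away from zero in one
   coordinate would generate [l_1], which [l_{p_5}] estimates forbid. *)
Lemma core_null a b i n (d : R) : 0 < d -> exists t0, forall t, (t0 <= t)%N ->
  nrm (T (zpair p k e a b t) i n) <= d.
Proof.
move=> d0; have d20 : 0 < d / 2 by rewrite divr_gt0.
have [t1 h1] := @core_null_real (@complex.Re R) a b (raddfD _)
  (fun c x => ltac:(by case: x => x y; rewrite /= mul0r subr0)) (@ler_Re_nrm R) i n _ d20.
have [t2 h2] := @core_null_real (@complex.Im R) a b (raddfD _)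
  (fun c x => ltac:(by case: x => x y; rewrite /= mul0r addr0)) (@ler_Im_nrm R) i n _ d20.
exists (maxn t1 t2) => t; rewrite geq_max => /andP[tt1 tt2].
apply: le_trans (ler_nrm_ReIm _) _.
by rewrite (splitr d); apply: lerD; [exact: h1|exact: h2].
Qed.

Lemma core_Tpsum ts M a b :
  T (psum p k e (fun=> 1) ts M a b) = \sum_(l < M) T (zpair p k e a b (ts l)).
Proof. by rewrite core_Tsum; apply: eq_bigr => l _; rewrite scale1r. Qed.

(** If the parts in [D] stayed above [c], sums of [M] images would have length at least of order
    [M^(1 / r)], while those of the preimages grow at most like [M^(1 / p_5)], a smaller power. *)
Lemma core_late (r : R) (D : pred I) a b c : (p : R) <= r -> r < (e 5 : R) ->
  (forall i, D i -> (p : R) <= (s i : R) <= r) -> 0 < c ->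
  exists t0, forall t, (t0 <= t)%N ->
    nrm (lp_restr D (T (zpair p k e a b t))) < c.
Proof.
move=> pr re Dr c0; have r0 := lt_le_trans (exponent_gt0 p) pr.
have a0 : 0 < r^-1 - (e 5 : R)^-1.
  by rewrite subr_gt0 ltf_pV2// posrE (lt_trans r0).
have [M [M0 BM]] := exists_nat_powR_gt (C * pair_size a b / c) a0.
have MM : 0 < M%:R :> R by rewrite ltr0n.
apply: (@flat_eventually_small _ p _ s _ D r c
   (C * (pair_size a b * M%:R `^ (e 5 : R)^-1)) M) => //.
- by move=> i n d; exact: core_null.
- move=> ts tsl; rewrite -core_Tpsum; apply: le_trans (TC _) _.
  rewrite ler_wpM2l ?(ltW C0)//; apply: psum_le_last => // l.
  exact: nrm1.
have -> : M%:R `^ r^-1 = M%:R `^ (r^-1 - (e 5 : R)^-1) * M%:R `^ (e 5 : R)^-1.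
  by rewrite -powRD ?subrK// (gt_eqF MM) implybT.
by rewrite mulrA [ltRHS]mulrAC ltr_pM2r ?powR_gt0// -ltr_pdivrMr.
Qed.

(** The sum of the five coordinate norms of [N ^ u] copies of [a x + b y], divided by [m ^ u]. *)
Definition core_poly (a b : R[i]) (u : nat) : R :=
  nrm a + w ^+ u * nrm b + w ^+ (u * 2) / w ^+ 2 * nrm a +
  w ^+ (u * 3) / w ^+ 8 * nrm (a + b) +
  w ^+ (u * 4) / w ^+ 24 * nrm (a + 'i%C * b).

Lemma core_polyE a b u :
  \sum_(j < 5) (N ^ u)%:R `^ (e j.+1 : R)^-1 * nrm (ell5_coef k e a b j) =
  m ^+ u * core_poly a b u.
Proof.
have gE n (x : R[i]) : nrm ((gamma k e n%:R)%:C%C * x) = (w ^+ n)^-1 * nrm x.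
  by rewrite nrmM nrmC ger0_norm ?gammaE// invr_ge0 exprn_ge0// ltW.
rewrite (eq_bigr (fun j : 'I_5 =>
  m ^+ u * (w ^+ (u * j) * nrm (ell5_coef k e a b j)))); last first.
  by move=> j _; rewrite core_powN mulrA.
rewrite -mulr_sumr; congr (_ * _).
rewrite !big_ord_recr big_ord0 /ell5_coef/= !(gE 2%N, gE 8%N, gE 24%N).
by rewrite add0r muln0 muln1 expr0 mul1r !mulrA.
Qed.

Lemma core_w i j l : (i <= j + l)%N -> w ^+ i / w ^+ j <= w ^+ l.
Proof.
move=> ijl; rewrite ler_pdivrMr ?exprn_gt0// -exprD ler_weXn2l//.
by rewrite addnC.
Qed.

(** Compare the two sides at [M = N ^ u]: the sum of preimages has norm at most [m ^ u K w ^ l],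
    whereas disjoint vectors of norm [c] in the own summand [j] would give [m ^ u w ^ (u j) c].
    Passing from [K] to [K + 1] provides the strict inequality. *)
Lemma core_own a b u (K : R) l (j : 'I_5) : 0 <= K ->
  core_poly a b u <= K * w ^+ l ->
  exists t0, forall t, (t0 <= t)%N ->
    nrm (T (zpair p k e a b t) (own j)) < (K + 1) * C * (w ^+ l / w ^+ (u * j)).
Proof.
move=> K0 pK.
have mu0 : 0 < m ^+ u by rewrite exprn_gt0.
have wj0 : 0 < w ^+ (u * j) by rewrite exprn_gt0.
have one (l' : nat) : nrm ((fun=> 1 : R[i]) l') = 1 by exact: nrm1.
have ev : exists t0, forall t, (t0 <= t)%N ->
    nrm (lp_restr (pred1 (own j)) (T (zpair p k e a b t))) <
    (K + 1) * C * (w ^+ l / w ^+ (u * j)).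
  apply: (@flat_eventually_small _ p _ s _ _ (e j.+1) _
    (C * (m ^+ u * (K * w ^+ l))) (N ^ u)).
  - by move=> i n d; exact: core_null.
  - exact: pe.
  - by move=> i /eqP ->; rewrite sown pe lexx.
  - by rewrite expn_gt0 N_km_gt0.
  - move=> ts tsl; rewrite -core_Tpsum; apply: le_trans (TC _) _.
    rewrite ler_wpM2l ?(ltW C0)//; apply: le_trans (psum_le _ _ _ _ _ _ one tsl) _.
    by rewrite core_polyE ler_wpM2l// ltW.
  rewrite core_powN.
  have -> : m ^+ u * w ^+ (u * j) * ((K + 1) * C * (w ^+ l / w ^+ (u * j))) =
      C * (m ^+ u * ((K + 1) * w ^+ l)).
    by field; rewrite gt_eqF.
  by rewrite ltr_pM2l// ltr_pM2l// ltr_pM2r ?ltrDl// exprn_gt0.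
have [t0 t0P] := ev; exists t0 => t tt0; apply: le_lt_trans (t0P t tt0).
have := nrm_lp_coord (lp_restr (pred1 (own j)) (T (zpair p k e a b t))) (own j).
by rewrite lp_restrE/= eqxx.
Qed.

(** * The images of the four lines *)

Local Notation X t := (T (zpair p k e 1 0 t)).
Local Notation Y t := (T (zpair p k e 0 1 t)).

(** The two conditions that follow concern only the component itself: on the other components of the
    image the signs may be either way, so nothing beyond real-linearity is asked of [T] there. *)
Hypothesis Tset : forall x (j : 'I_5) n,
  T x (own j) n = ell5_coef k e (T x (own idx0) n) (T x (own idx1) n) j.
Hypothesis Tanti : forall x (j : 'I_5) n,
  T ('i%C *: x) (own j) n = - ('i%C * T x (own j) n).

(* At scale [N], the vector [x] is short and [f_2] is long: the [y]-component
   of [T x] is small. *)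
Lemma core_gamma : exists t0, forall t, (t0 <= t)%N ->
  nrm (X t (own idx1)) < 5 * C / w.
Proof.
have [|t0 t0P] := @core_own 1 0 1 4 0 idx1 ltac:(by []).
  rewrite /core_poly !mul1n mulr0 !addr0 nrm0 nrm1 !mulr1 mulr0 addr0.
  rewrite divff ?expf_neq0 ?gt_eqF//.
  have h1 := @core_w 3 8 0 isT; have h2 := @core_w 4 24 0 isT.
  by rewrite expr0 in h1 h2 *; lra.
exists t0 => t /t0P; rewrite expr0 mul1n expr1 mul1r.
by rewrite (_ : 4 + 1 = 5 :> R)//; lra.
Qed.

(* At scale [N^4], [f_3] dominates and [y] is short. *)
Lemma core_beta (j : 'I_5) : exists t0, forall t, (t0 <= t)%N ->
  nrm (Y t (own j)) < 4 * C * (w ^+ 4 / w ^+ (4 * j)).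
Proof.
have [|t0 t0P] := @core_own 0 1 4 3 4 j ltac:(by []).
  rewrite /core_poly nrm0 !add0r mulr1 nrm1 !mulr0 !mulr1 addr0 nrmi mulr1.
  have h1 := @core_w 12 8 4 isT; have h2 := @core_w 16 24 4 isT.
  by move: h1 h2; rewrite (_ : (4 * 3 = 12)%N)// (_ : (4 * 4 = 16)%N)//; lra.
by exists t0 => t /t0P; rewrite (_ : 3 + 1 = 4 :> R)//; lra.
Qed.

(* At scale [N^10], [f_4] dominates and [x - y] is short. *)
Lemma core_sum : exists t0, forall t, (t0 <= t)%N ->
  nrm (T (zpair p k e 1 (-1) t) (own idx3)) < 6 * C * (w ^+ 18 / w ^+ 30).
Proof.
have [|t0 t0P] := @core_own 1 (-1) 10 5 18 idx3 ltac:(by []).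
  rewrite /core_poly subrr nrm0 mulr0 addr0 nrmN nrm1 !mulr1.
  have h0 := @core_w 0 0 18 isT.
  have h1 := @core_w 10 0 18 isT; have h2 := @core_w 20 2 18 isT.
  have h3 := @core_w 40 24 18 isT.
  have h4 : nrm (1 + 'i%C * (-1) : R[i]) <= 2.
    by rewrite mulrN1 (le_trans (ler_nrmB _ _))// nrm1 nrmi.
  have h5 : w ^+ 40 / w ^+ 24 * nrm (1 + 'i%C * (-1) : R[i]) <= w ^+ 18 * 2.
    by apply: ler_pM; rewrite ?nrm_ge0 ?divr_ge0 ?exprn_ge0// ltW.
  move: h0 h1 h2 h5; rewrite expr0 invr1 !mulr1.
  by rewrite (_ : (10 * 2 = 20)%N)// (_ : (10 * 4 = 40)%N)//; lra.
by exists t0 => t /t0P; rewrite (_ : 5 + 1 = 6 :> R)//; lra.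
Qed.

(* At scale [N^18], [f_5] dominates and [x + i y] is short. *)
Lemma core_skew : exists t0, forall t, (t0 <= t)%N ->
  nrm (T (zpair p k e 1 'i%C t) (own idx4)) < 6 * C * (w ^+ 46 / w ^+ 72).
Proof.
have [|t0 t0P] := @core_own 1 'i%C 18 5 46 idx4 ltac:(by []).
  rewrite /core_poly -expr2 sqr_i subrr nrm0 mulr0 addr0 nrmi nrm1 !mulr1.
  have h0 := @core_w 0 0 46 isT.
  have h1 := @core_w 18 0 46 isT; have h2 := @core_w 36 2 46 isT.
  have h3 := @core_w 54 8 46 isT.
  have h4 : nrm (1 + 'i%C : R[i]) <= 2.
    by rewrite (le_trans (ler_nrmD _ _))// nrm1 nrmi.
  have h5 : w ^+ 54 / w ^+ 8 * nrm (1 + 'i%C : R[i]) <= w ^+ 46 * 2.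
    by apply: ler_pM; rewrite ?nrm_ge0 ?divr_ge0 ?exprn_ge0// ltW.
  move: h0 h1 h2 h5; rewrite expr0 invr1 !mulr1.
  by rewrite (_ : (18 * 2 = 36)%N)// (_ : (18 * 3 = 54)%N)//; lra.
by exists t0 => t /t0P; rewrite (_ : 5 + 1 = 6 :> R)//; lra.
Qed.

Lemma core_gammaK (n : nat) :
  (w ^+ n)%:C%C * (gamma k e n%:R)%:C%C = 1 :> R[i].
Proof. by rewrite -rmorphM/= gammaE divff ?expf_neq0 ?gt_eqF. Qed.

(** The cross-ratio argument in explicit form. Let [T x], [T y] have first two own coordinates
    [(al, ga)], [(be, de)]. By antilinearity the form [a + i b] on [T (x + i y)] is
    [al - i be + i ga + de], and the form [a + b] on [T (x - y)] is [al - be + ga - de]; their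
    difference is [2 de + (1 - i) (be - ga)]. For a linear map [de] would cancel. The weights turn
    the forms into coordinates, at the price of powers of [w]. *)
Lemma core_delta_le t :
  2 * nrm (Y t (own idx1)) <=
  w ^+ 24 * nrm (T (zpair p k e 1 'i%C t) (own idx4)) +
  w ^+ 8 * nrm (T (zpair p k e 1 (-1) t) (own idx3)) +
  2 * w ^+ 2 * nrm (Y t (own idx2)) + 2 * nrm (X t (own idx1)).
Proof.
have e21 : (s (own idx2) : R) <= (s (own idx1) : R) by rewrite !sown core_edecr.
have e32 : (s (own idx3) : R) <= (s (own idx2) : R) by rewrite !sown core_edecr.
have e43 : (s (own idx4) : R) <= (s (own idx3) : R) by rewrite !sown core_edecr.
have e31 := le_trans e32 e21; have e41 := le_trans e43 e31.
set L := T (zpair p k e 1 'i%C t); set S := T (zpair p k e 1 (-1) t).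
have SE : S = X t - Y t.
  rewrite -core_TN -TD; congr T; rewrite -[- zpair p k e 0 1 t]scaleN1r -zpairZ -zpairD.
  by rewrite mulr0 addr0 add0r mulr1.
have LE : L = X t + T ('i%C *: zpair p k e 0 1 t).
  by rewrite -TD -zpairZ -zpairD mulr0 addr0 add0r mulr1.
pose L' : lp_sum (s (own idx1)) (fun _ : nat => R[i]^o) :=
  LpSum (lp_finite_incl e41 (L (own idx4))).
pose S' : lp_sum (s (own idx1)) (fun _ : nat => R[i]^o) :=
  LpSum (lp_finite_incl e31 (S (own idx3))).
pose B' : lp_sum (s (own idx1)) (fun _ : nat => R[i]^o) :=
  LpSum (lp_finite_incl e21 (Y t (own idx2))).
have L'L : nrm L' <= nrm (L (own idx4)) by exact: nrm_lp_incl.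
have S'S : nrm S' <= nrm (S (own idx3)) by exact: nrm_lp_incl.
have B'B : nrm B' <= nrm (Y t (own idx2)) by exact: nrm_lp_incl.
have i1n : nrm (1 - 'i%C : R[i]) <= 2.
  by rewrite (le_trans (ler_nrmB _ _))// nrm1 nrmi.
have -> : 2 * nrm (Y t (own idx1)) = nrm ((2%:C%C : R[i]) *: Y t (own idx1)).
  by rewrite nrmZ nrmC normr_nat.
have -> : (2%:C%C : R[i]) *: Y t (own idx1) =
    (w ^+ 24)%:C%C *: L' - (w ^+ 8)%:C%C *: S' -
    ((1 - 'i%C) * (w ^+ 2)%:C%C) *: B' + (1 - 'i%C) *: X t (own idx1).
  apply: lp_sumP => n.
  have -> : ((w ^+ 24)%:C%C *: L' - (w ^+ 8)%:C%C *: S' -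
      ((1 - 'i%C) * (w ^+ 2)%:C%C) *: B' + (1 - 'i%C) *: X t (own idx1)) n =
    (w ^+ 24)%:C%C * L (own idx4) n - (w ^+ 8)%:C%C * S (own idx3) n -
    ((1 - 'i%C) * (w ^+ 2)%:C%C) * Y t (own idx2) n + (1 - 'i%C) * X t (own idx1) n.
    by [].
  rewrite (Tset (zpair p k e 1 'i%C t) idx4) (Tset (zpair p k e 1 (-1) t) idx3).
  rewrite (Tset (zpair p k e 0 1 t) idx2) -/L -/S.
  rewrite LE SE !flat_addE !flat_oppE !Tanti.
  set al := X t (own idx0) n; set ga := X t (own idx1) n.
  set be := Y t (own idx0) n; set de := Y t (own idx1) n.
  have -> : ((2%:C%C : R[i]) *: Y t (own idx1)) n = 2%:C%C * de by [].
  rewrite /ell5_coef/= !mulrA core_gammaK core_gammaK -(mulrA _ _ (gamma k e 2)%:C%C).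
  rewrite core_gammaK.
  have ii : 'i%C * 'i%C = -1 :> R[i] by rewrite -expr2 sqr_i.
  ring: ii.
apply: le_trans (ler_nrmD _ _) (lerD (le_trans (ler_nrmB _ _)
  (lerD (le_trans (ler_nrmB _ _) (lerD _ _)) _)) _).
- rewrite nrmZ nrmC ger0_norm ?exprn_ge0 ?(ltW w0)//.
  by rewrite ler_wpM2l// exprn_ge0 ?(ltW w0).
- rewrite nrmZ nrmC ger0_norm ?exprn_ge0 ?(ltW w0)//.
  by rewrite ler_wpM2l// exprn_ge0 ?(ltW w0).
- rewrite nrmZ nrmM nrmC ger0_norm ?exprn_ge0 ?(ltW w0)//.
  by apply: ler_pM; rewrite ?mulr_ge0 ?nrm_ge0 ?exprn_ge0 ?(ltW w0)//
    ler_wpM2r// exprn_ge0 ?(ltW w0).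
- by rewrite nrmZ ler_wpM2r// nrm_ge0.
Qed.

Lemma core_scale i j l (x K : R) : 0 <= K -> (i + j < l)%N ->
  x <= K * (w ^+ j / w ^+ l) -> w ^+ i * x <= K / w.
Proof.
move=> K0 ijl xK; have wi0 : 0 <= w ^+ i by rewrite exprn_ge0 ?(ltW w0).
apply: le_trans (ler_wpM2l wi0 xK) _.
have -> : w ^+ i * (K * (w ^+ j / w ^+ l)) = K * (w ^+ (i + j) / w ^+ l).
  by rewrite exprD; ring.
rewrite ler_wpM2l//.
rewrite ler_pdivrMr ?exprn_gt0// ler_pdivlMl// -exprS.
by rewrite ler_weXn2l.
Qed.

Lemma core_delta : exists t0, forall t, (t0 <= t)%N ->
  nrm (Y t (own idx1)) <= 15 * C / w.
Proof.
have [t1 h1] := core_gamma; have [t2 h2] := core_beta idx2.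
have [t3 h3] := core_sum; have [t4 h4] := core_skew.
exists (maxn (maxn t1 t2) (maxn t3 t4)) => t.
rewrite !geq_max => /andP[/andP[{}/h1 h1 {}/h2 h2] /andP[{}/h3 h3 {}/h4 h4]].
have wn0 n : 0 <= w ^+ n by rewrite exprn_ge0 ?(ltW w0).
have wV : 0 < w^-1 by rewrite invr_gt0.
have C60 : 0 <= 6 * C by rewrite mulr_ge0 ?(ltW C0).
have C40 : 0 <= 4 * C by rewrite mulr_ge0 ?(ltW C0).
have k2 := @core_scale 2 4 8 _ _ C40 isT (ltW h2).
have k3 := @core_scale 8 18 30 _ _ C60 isT (ltW h3).
have k4 := @core_scale 24 46 72 _ _ C60 isT (ltW h4).
(* The four terms contribute [6 + 6 + 2 * 4 + 2 * 5 = 30] times [C / w], twice the claimed 15. *)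
rewrite -(ler_pM2l (ltr0Sn R 1)); apply: le_trans (core_delta_le t) _.
by move: h1 k2 k3 k4; rewrite -!mulrA; lra.
Qed.

Lemma core_Y_le t : nrm (Y t) <= 3 * C.
Proof.
apply: le_trans (TC _) _; rewrite mulrC ler_wpM2r ?(ltW C0)//.
have tsl l : (t + l < t + l.+1)%N by rewrite ltn_add2l.
(* A single vector is the sum at scale [N ^ 0]; the polynomial is then at most 3. *)
have := @psum_le _ p k e (fun=> 1) (fun l => t + l)%N (N ^ 0) 0 1
  (fun=> nrm1) tsl.
rewrite core_polyE expr0 mul1r expn0 /psum big_ord1 scale1r addn0.
move=> /le_trans; apply.
rewrite /core_poly nrm0 !add0r mulr1 nrm1 !mulr0 !mulr1 addr0 nrmi mulr1.
have h1 := @core_w 0 8 0 isT; have h2 := @core_w 0 24 0 isT.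
by move: h1 h2; rewrite !mul0n expr0; lra.
Qed.

(** The sum of [N] vectors [y_t] has norm at least [m w], seen in [l_{p_2}]. Its image is nearly a
    sum of disjoint blocks, and the own, early and late coordinates together give it norm at most
    [47 C m]; boundedness below then gives [m w <= 47 C ^ 2 m]. *)
Lemma core_bound (q r : R) (n : nat) (early : seq I) :
  (forall x, nrm x <= C * nrm (T x)) ->
  0 < q -> n%:R * eta_km e < (e 1 : R)^-1 - q^-1 -> n%:R <= w ^+ n ->
  (size early <= 5 * n)%N -> (forall i, i \in early -> q <= (s i : R)) ->
  (p : R) <= r -> r < (e 5 : R) ->
  (forall i, i \notin early -> (forall j, i != own j) ->
     (p : R) <= (s i : R) <= r) ->
  w <= 47 * C ^+ 2.
Proof.
move=> Tge q0 nq nw szE qE pr re late.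
pose fin := early ++ [seq own j | j <- enum 'I_5].
pose D : pred I := fun i => i \notin fin.
have Dlate i : D i -> (p : R) <= (s i : R) <= r.
  rewrite /D mem_cat negb_or => /andP[iE io]; apply: late => // j.
  by apply: contraNneq io => ->; rewrite map_f// mem_enum.
have NN0 : 0 < 2 * N%:R :> R by rewrite mulr_gt0.
(* An error [d] for each of [N] terms adds up to [m / 2]; this is spent once on the late coordinates
   and once on the gliding hump. *)
pose d := m / (2 * N%:R).
have d0 : 0 < d by rewrite divr_gt0.
have dN : N%:R * d = m / 2 by rewrite /d; field; rewrite gt_eqF.
have [t1 h1] := core_late (D := D) 0 1 pr re Dlate d0.
have [t2 h2] := core_delta.
have [t32 h32] := core_beta idx2.
have [t33 h33] := core_beta idx3; have [t34 h34] := core_beta idx4.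
pose t' := maxn (maxn t1 t2) (maxn t32 (maxn t33 t34)).
have [ts [u [tsl tst Yu du uY]]] := @gliding_hump _ p _ s (fun t => Y t)
  (fun t => (t' <= t)%N) d d0 (fun i n d => @core_null 0 1 i n d)
  (fun t0 => ex_intro _ (maxn t0 t') (conj (leq_maxl _ _) (leq_maxr _ _))).
move UE : (\sum_(l < N) u l) => U.
have Ui i : U i = \sum_(l < N) u l i by rewrite -UE lp_sum_sumE.
have own_le (c : R) (j : 'I_5) : 0 <= c ->
    (forall l, nrm (Y (ts l) (own j)) <= c) ->
    nrm (U (own j)) <= m * (w ^+ j * c).
  move=> c0 Yc; rewrite Ui.
  apply: le_trans (nrm_flat_disjoint_le N (i := own j) c0 du _) _.
    by move=> l; apply: le_trans (uY l _) (Yc l).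
  by have := core_powN 1 j; rewrite expn1 expr1 mul1n sown mulrA => ->.
have tl l : [/\ (t1 <= ts l)%N, (t2 <= ts l)%N, (t32 <= ts l)%N,
    (t33 <= ts l)%N & (t34 <= ts l)%N].
  have := tst l; rewrite /t' !geq_max.
  by move=> /andP[/andP[-> ->] /andP[-> /andP[-> ->]]].
have C40 : 0 <= 4 * C by rewrite mulr_ge0 ?(ltW C0).
have ww0 i j : 0 <= w ^+ i / w ^+ j by rewrite divr_ge0 ?exprn_ge0 ?(ltW w0).
have cw (i j : nat) : (i + 4 <= j)%N -> w ^+ i * (4 * C * (w ^+ 4 / w ^+ j)) <= 4 * C.
  move=> ij; have -> : w ^+ i * (4 * C * (w ^+ 4 / w ^+ j)) =
    4 * C * (w ^+ (i + 4) / w ^+ j) by rewrite exprD; ring.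
  by rewrite ler_piMr// -(expr0 w); apply: core_w; rewrite addn0.
have U2 : nrm (U (own idx2)) <= m * (4 * C).
  apply: le_trans (own_le _ idx2 _ (fun l => ltW (h32 _ _))) _; first exact: mulr_ge0.
    by move=> l; have [] := tl l.
  by rewrite ler_wpM2l ?(ltW m0)//; exact: cw.
have U3 : nrm (U (own idx3)) <= m * (4 * C).
  apply: le_trans (own_le _ idx3 _ (fun l => ltW (h33 _ _))) _; first exact: mulr_ge0.
    by move=> l; have [] := tl l.
  by rewrite ler_wpM2l ?(ltW m0)//; exact: cw.
have U4 : nrm (U (own idx4)) <= m * (4 * C).
  apply: le_trans (own_le _ idx4 _ (fun l => ltW (h34 _ _))) _; first exact: mulr_ge0.
    by move=> l; have [] := tl l.
  by rewrite ler_wpM2l ?(ltW m0)//; exact: cw.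
have U1 : nrm (U (own idx1)) <= m * (15 * C).
  apply: le_trans (own_le (15 * C / w) idx1 _ (fun l => h2 _ _)) _.
  - by rewrite divr_ge0 ?mulr_ge0 ?(ltW C0) ?(ltW w0).
  - by move=> l; have [] := tl l.
  have -> : w ^+ idx1 * (15 * C / w) = 15 * C by rewrite expr1 mulrC divfK ?gt_eqF.
  exact: lexx.
(* The direct estimate of the first coordinate at scale [N ^ 4] would be too large by [w ^ 4]. It is
   recovered instead from the third one, of which it is [w ^ 2] times. *)
have U0 : nrm (U (own idx0)) <= m * (4 * C).
  apply: le_trans (own_le (4 * C) idx0 _ _) _ => //; last by rewrite expr0 mul1r.
  move=> l; have [_ _ l32 _ _] := tl l.
  have {}l32 := ltW (h32 _ l32).
  apply: le_trans (cw 2%N 8%N isT).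
  apply: le_trans (ler_wpM2l _ l32); last by rewrite exprn_ge0 ?(ltW w0).
  have e20 : (s (own idx2) : R) <= (s (own idx0) : R) by rewrite !sown core_edecr.
  pose B : lp_sum (s (own idx0)) (fun _ : nat => R[i]^o) :=
    LpSum (lp_finite_incl e20 (Y (ts l) (own idx2))).
  have -> : Y (ts l) (own idx0) = (w ^+ 2)%:C%C *: B.
    apply: lp_sumP => i.
    have -> : ((w ^+ 2)%:C%C *: B) i = (w ^+ 2)%:C%C * Y (ts l) (own idx2) i by [].
    by rewrite [in RHS]Tset /ell5_coef/= mulrA core_gammaK mul1r.
  rewrite nrmZ nrmC ger0_norm ?exprn_ge0 ?(ltW w0)// ler_wpM2l ?exprn_ge0 ?(ltW w0)//.
  exact: nrm_lp_incl.
(* An early exponent is at least [q], so each coordinate has norm at most [3 C N^(1 / q)], which the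
   gap condition bounds by [3 C m / w ^ n]. There are at most [5 n <= 5 w ^ n] of them. *)
have early_le : \sum_(i <- early) nrm (U i) <= m * (15 * C).
  have Nq : N%:R `^ q^-1 <= m / w ^+ n.
    rewrite ler_pdivlMr ?exprn_gt0//.
    have -> : w ^+ n = N%:R `^ (n%:R * eta_km e).
      by rewrite mulrC powRrM powR_mulrn// powR_ge0.
    rewrite -powRD ?(gt_eqF N0) ?implybT// ler_powR ?ler1n ?N_km_gt0//.
    by rewrite addrC -lerBrDr ltW.
  have iq i : i \in early -> nrm (U i) <= N%:R `^ q^-1 * (3 * C).
    move=> iE; rewrite Ui; have C30 : 0 <= 3 * C by rewrite mulr_ge0 ?(ltW C0).
    apply: le_trans (nrm_flat_disjoint_le N (i := i) C30 du _) _.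
      move=> l; apply: le_trans (uY l i) _.
      by apply: le_trans (nrm_lp_coord _ i) (core_Y_le _).
    rewrite ler_wpM2r// ler_powR ?ler1n ?N_km_gt0// lef_pV2 ?posrE//.
      exact: qE.
    exact: exponent_gt0.
  apply: le_trans (_ : \sum_(i <- early) (N%:R `^ q^-1 * (3 * C)) <= _).
    by rewrite big_seq [leRHS]big_seq; apply: ler_sum.
  rewrite big_const_seq count_predT iter_addr_0 -[leLHS]mulr_natl.
  have sz : (size early)%:R <= 5 * w ^+ n.
    apply: le_trans (_ : (5 * n)%:R <= _); first by rewrite ler_nat.
    by rewrite natrM ler_wpM2l.
  apply: le_trans (ler_pM _ _ sz (ler_wpM2r _ Nq)) _ => //.
  - by rewrite !mulr_ge0 ?powR_ge0 ?(ltW C0).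
  - by rewrite mulr_ge0 ?(ltW C0).
  by rewrite le_eqVlt; apply/orP; left; apply/eqP; field; rewrite expf_neq0 ?gt_eqF.
(* Four own coordinates at 4, the second one at 15, and 15 for the early ones:
   [46 = 16 + 15 + 15]. *)
have fin_le : nrm (lp_restr (fun i => i \in fin) U) <= m * (46 * C).
  apply: le_trans (nrm_lp_fin_seq (r := fin) _) _ => [i ifin|].
    by rewrite lp_restrE (negPf ifin).
  apply: le_trans (_ : \sum_(i <- fin) nrm (U i) <= _).
    apply: ler_sum => i _; rewrite lp_restrE.
    by case: ifP => _; rewrite ?nrm0 ?nrm_ge0.
  rewrite big_cat/= big_map big_enum/= sum_ord5.
  by move: U0 U1 U2 U3 U4 early_le; lra.
have late_le : nrm (lp_restr D U) <= m / 2.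
  rewrite -UE lp_restr_sum; apply: le_trans (ler_nrm_sum _ _ _) _.
  rewrite -dN; apply: le_trans (_ : \sum_(l < N) d <= _).
    apply: ler_sum => l _; have [l1 _ _ _ _] := tl l.
    apply: le_trans (ltW (h1 _ l1)); apply: nrm_lp_dom1 => i.
    by rewrite !lp_restrE; case: (D i); [exact: uY|rewrite !nrm0].
  by rewrite sumr_const card_ord -[leLHS]mulr_natl.
have YU : nrm (\sum_(l < N) Y (ts l) - U) <= m / 2.
  rewrite -UE -sumrB; apply: le_trans (ler_nrm_sum _ _ _) _.
  rewrite -dN; apply: le_trans (_ : \sum_(l < N) d <= _).
    by apply: ler_sum => l _; exact: Yu.
  by rewrite sumr_const card_ord -[leLHS]mulr_natl.
have UD : U = lp_restr (fun i => i \in fin) U + lp_restr D U.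
  apply: lp_sumP => i; rewrite lp_sum_addE !lp_restrE /D.
  by case: (i \in fin); rewrite ?addr0 ?add0r.
have Ule : nrm (\sum_(l < N) Y (ts l)) <= m * (47 * C).
  rewrite -(subrK U (\sum_(l < N) _)); apply: le_trans (ler_nrmD _ _) _.
  have UU : nrm U <= m * (46 * C) + m / 2.
    by rewrite UD; apply: le_trans (ler_nrmD _ _) (lerD _ _).
  apply: le_trans (lerD YU UU) _.
  have : m * 1 <= m * C by rewrite ler_wpM2l// ltW.
  by rewrite mulr1; lra.
have low := @psum_ge _ p k e (fun=> 1) ts (N ^ 1) 0 1 (fun=> nrm1) tsl idx1.
rewrite core_powN expr1 mul1n expr1 expn1 /ell5_coef/= nrm1 mulr1 in low.
have := le_trans low (Tge _); rewrite core_Tpsum => low'.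
rewrite -(ler_pM2l m0); apply: le_trans low' _.
apply: le_trans (ler_wpM2l (ltW C0) Ule) _.
by rewrite le_eqVlt; apply/orP; left; apply/eqP; ring.
Qed.

End core.

(** * The space X and its sign structures *)

Lemma bounded_operator_exists (R : realType) (V : normedModType R[i]) (c : R)
    (f : V -> V) : 0 <= c -> {morph f : x y / x + y} ->
  (forall (a : R) x, f (a%:C%C *: x) = a%:C%C *: f x) ->
  (forall x, nrm (f x) <= c * nrm x) ->
  exists A : bounded_operator (realification V) (realification V), A = f :> (V -> V).
Proof.
move=> c0 fD fZ fc.
have flin : linear (f : realification V -> realification V).
  by move=> a x y; rewrite [LHS]fD; congr (_ + _); exact: fZ.
pose f' := GRing.isLinear.Build R (realification V) (realification V) *:%R f flin.
pose F : {linear realification V -> realification V} := HB.pack f f'.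
have Fb : bounded_near F (nbhs (0 : realification V)).
  apply/linear_boundedP; near=> r => x.
  rewrite !realification_normE -!nrmE; apply: le_trans (fc x) _.
  by rewrite ler_wpM2r ?nrm_ge0//; near: r; exact: nbhs_pinfty_ge.
by exists (BoundedOperator Fb).
Unshelve. all: by end_near. Qed.

Lemma bounded_operator_bound (R : realType) (V : normedModType R[i])
    (A : bounded_operator (realification V) (realification V)) :
  exists c : R, 1 <= c /\ forall x : V, nrm (A x : V) <= c * nrm x.
Proof.
have /linear_boundedP/pinfty_ex_gt0[c c0 Ac] := bop_bounded A.
exists (Num.max 1 c); split; first by rewrite le_max lexx.
move=> x; have := Ac x; rewrite !realification_normE -!nrmE => /le_trans; apply.
by rewrite ler_wpM2r ?nrm_ge0// le_max lexx orbT.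
Qed.

Section Xspace.
Context {R : realType} (p : exponent R) (P : nat -> nat -> nat -> exponent R).
Local Notation X := (X_complex p P).
Local Notation Z k m := (X_component p k.+1 (P k.+1 m.+1)).

Definition xc (x : X) (k m : nat) : Z k m := x k m.

Lemma xcD (x y : X) k m : xc (x + y) k m = xc x k m + xc y k m.
Proof. by []. Qed.

Lemma xcZ a (x : X) k m : xc (a *: x) k m = a *: xc x k m.
Proof. by []. Qed.

Lemma xcP (x y : X) : (forall k m, xc x k m = xc y k m) -> x = y.
Proof. by move=> xy; apply: lp_sumP => k; apply: lp_sumP => m; exact: xy. Qed.

Definition flat_index : choiceType := (nat * (nat * 'I_5))%type.
Definition flat_exp (i : flat_index) : exponent R := P i.1.+1 i.2.1.+1 i.2.2.+1.

Definition to_flat_fun (x : X) (i : flat_index) :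
    lp_sum (flat_exp i) (fun _ : nat => R[i]^o) :=
  (val (xc x i.1 i.2.1) : ell5 p (P i.1.+1 i.2.1.+1)) i.2.2.

(** The same [p] governs all three levels of summation, so nonnegative sums may be merged into one
    over the triples. *)
Lemma to_flat_mass (x : X) :
  lp_mass p (to_flat_fun x) = (nrm x `^ p)%:E.
Proof.
rewrite lp_mass_esum -lp_massE lp_mass_esum.
have T2 (T1 T2 : Type) : [set: T1] `*`` (fun=> [set: T2]) = [set: T1 * T2].
  by apply/seteqP.
rewrite (eq_esum (b := fun k : nat => \esum_(i in [set: nat * 'I_5])
    (nrm (to_flat_fun x (k, i)) `^ p)%:E)); last first.
  move=> k _; rewrite -lp_massE lp_mass_esum.
  rewrite (eq_esum (b := fun m : nat => \esum_(j in [set: 'I_5])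
    (nrm (to_flat_fun x (k, (m, j))) `^ p)%:E)); last first.
    by move=> m _; rewrite nrm_component -lp_massE lp_mass_esum.
  rewrite esum_esum; last by move=> i j _ _; rewrite lee_fin powR_ge0.
  by rewrite T2; apply: eq_esum => -[].
rewrite esum_esum; last by move=> i j _ _; rewrite lee_fin powR_ge0.
by rewrite T2; apply: eq_esum => -[].
Qed.

Lemma to_flat_finite (x : X) : (lp_mass p (to_flat_fun x) < +oo)%E.
Proof. by rewrite to_flat_mass ltry. Qed.

Definition to_flat (x : X) : flat p flat_exp := LpSum (to_flat_finite x).

Lemma nrm_to_flat x : nrm (to_flat x) = nrm x.
Proof.
have : (nrm (to_flat x) `^ p)%:E = (nrm x `^ p)%:E.
  by rewrite -to_flat_mass -lp_massE.
case=> /(powR_injective (exponent_gt0 p)); apply; rewrite nnegrE nrm_ge0//.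
Qed.

Lemma to_flatD : {morph to_flat : x y / x + y}.
Proof. by move=> x y; apply: flatP => -[k [m j]] n. Qed.

Lemma to_flatZ a x : to_flat (a *: x) = a *: to_flat x.
Proof. by apply: flatP => -[k [m j]] n. Qed.

Section xmap.
Variables (g : forall k m, Z k m -> Z k m) (c : R).
Hypothesis c0 : 0 <= c.
Hypothesis gD : forall k m, {morph @g k m : x y / x + y}.
Hypothesis gZ : forall k m (a : R) x, @g k m (a%:C%C *: x) = a%:C%C *: @g k m x.
Hypothesis gc : forall k m x, nrm (@g k m x) <= c * nrm x.

Lemma component_operator : exists A : bounded_operator (realification X)
    (realification X), forall x k m, xc (A x) k m = g (xc x k m).
Proof.
pose f : X -> X := lp_map (p := p) c0 (fun k x => nrm_lp_map c0 (@gc k) x).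
have fE x k m : xc (f x) k m = g (xc x k m) by [].
have [||||A Af] := @bounded_operator_exists R X c f.
- exact: c0.
- by move=> x y; apply: xcP => k m; rewrite xcD !fE xcD gD.
- by move=> a x; apply: xcP => k m; rewrite xcZ !fE xcZ gZ.
- exact: nrm_lp_map.
by exists A => x k m; rewrite Af fE.
Qed.

End xmap.

Definition unit_sign (b : bool) : R[i] := if b then 'i%C else - 'i%C.

Lemma nrm_unit_sign b : nrm (unit_sign b) = 1.
Proof. by case: b; rewrite /unit_sign ?nrmN nrmi. Qed.

Lemma unit_sign_sqr b : unit_sign b * unit_sign b = -1.
Proof. by case: b; rewrite /unit_sign ?mulrNN -expr2 sqr_i. Qed.

Lemma sign_operator_exists (al : nat -> nat -> bool) :
  exists A : bounded_operator (realification X) (realification X),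
    forall x k m, xc (A x) k m = unit_sign (al k m) *: xc x k m.
Proof.
apply: (@component_operator (fun k m z => unit_sign (al k m) *: z) 1) => //.
- by move=> k m x y; rewrite scalerDr.
- by move=> k m a x; rewrite !scalerA mulrC.
- by move=> k m x; rewrite nrmZ nrm_unit_sign.
Qed.

Definition sign_operator al := projT1 (cid (sign_operator_exists al)).

Lemma sign_operatorE al x k m :
  xc (sign_operator al x) k m = unit_sign (al k m) *: xc x k m.
Proof. exact: (projT2 (cid (sign_operator_exists al))). Qed.

Lemma sign_operator_structure al :
  complex_structure (realification X) (sign_operator al).
Proof.
move=> x; apply: xcP => k m.
by rewrite !sign_operatorE scalerA unit_sign_sqr scaleN1r.
Qed.

End Xspace.

(** * Isomorphism of sign structures *)

Section pair_order.

(** The map [succ_pair] for pairs counted from zero. *)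
Definition pair_next (c : nat * nat) : nat * nat :=
  if c.2 is m.+1 then (c.1.+1, m) else (0%N, c.1.+1).

Definition pair_nth i := iter i pair_next (0%N, 0%N).

(** The binomial coefficient counts the pairs on the earlier antidiagonals; the first entry is the
    position on the current one. *)
Definition pair_rank (c : nat * nat) : nat := 'C((c.1 + c.2).+1, 2) + c.1.

Lemma pair_rank_next c : pair_rank (pair_next c) = (pair_rank c).+1.
Proof.
case: c => k [|m]; rewrite /pair_rank/=.
  by rewrite add0n !addn0 (binS _ 1) bin1 addnS.
by rewrite addSn addnS addnS.
Qed.

Lemma pair_nthK i : pair_rank (pair_nth i) = i.
Proof. by elim: i => // i IH; rewrite /pair_nth/= pair_rank_next IH. Qed.

Lemma pair_rankK c : pair_nth (pair_rank c) = c.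
Proof.
suff [i <-] : exists i, pair_nth i = c by rewrite pair_nthK.
case: c => k m; move sE : (k + m)%N => s.
elim: s k m sE => [|s IHs].
  by move=> [|k] [|m]//= _; exists 0%N.
elim=> [|k IHk] m; rewrite ?add0n => sm.
  have [i iE] := IHs s 0%N (addn0 s).
  by exists i.+1; rewrite /pair_nth/= -/(pair_nth i) iE sm.
have [i iE] := IHk m.+1 ltac:(by rewrite addnS -addSn).
by exists i.+1; rewrite /pair_nth/= -/(pair_nth i) iE.
Qed.

Lemma pair_rank_lt k m : (pair_rank (k, m) < 'C((k + m).+2, 2))%N.
Proof.
by rewrite /pair_rank/= (binS (k + m).+1 1) bin1 ltn_add2l ltnS leq_addr.
Qed.

(** Identifies the constant of the gap condition with a binomial coefficient, which exceeds the rank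
    of the pair. *)
Lemma bin2_double n : ('C(n.+2, 2) * 2 = n.+1 * n.+2)%N.
Proof. by elim: n => // n IH; rewrite (binS n.+2 1) bin1 mulnDl IH; lia. Qed.

End pair_order.

(** * The conjugation as an antilinear involution *)

Section component_conjugation.
Context {R : realType} (p : exponent R) (k : nat) (e : nat -> exponent R).
Hypothesis eta0 : 0 < eta_km e.
Hypothesis edecr : forall j, (0 < j < 5)%N -> (e j.+1 : R) <= (e j : R).
Local Notation Z := (X_component p k e).

(** The forms [a + b] and [a + i b] are independent. As the conjugation is plain complex conjugation
    in these coordinates, its algebraic identities can be checked there. *)
Lemma zcP34 (z z' : Z) : (forall n, zc z idx3 n = zc z' idx3 n) ->
  (forall n, zc z idx4 n = zc z' idx4 n) -> z = z'.
Proof.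
have gK (n : nat) : injective ( *%R (gamma k e n%:R)%:C%C : R[i] -> R[i]).
  apply: mulfI; rewrite eq_complex/= eqxx andbT.
  by rewrite gt_eqF// (gamma_gt0 k eta0).
move=> h3 h4.
have {}h3 n : zc z idx0 n + zc z idx1 n = zc z' idx0 n + zc z' idx1 n.
  by apply: (gK 8%N); have := h3 n; rewrite zcE [RHS]zcE.
have {}h4 n : zc z idx0 n + 'i%C * zc z idx1 n = zc z' idx0 n + 'i%C * zc z' idx1 n.
  by apply: (gK 24%N); have := h4 n; rewrite zcE [RHS]zcE.
have h1 n : zc z idx1 n = zc z' idx1 n.
  have i10 : 1 - 'i%C != 0 :> R[i].
    by rewrite eq_complex/= subr0 oner_eq0.
  apply: (mulfI i10); rewrite !mulrBl !mul1r.
  have -> : zc z idx1 n - 'i%C * zc z idx1 n =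
    (zc z idx0 n + zc z idx1 n) - (zc z idx0 n + 'i%C * zc z idx1 n) by ring.
  by rewrite h3 h4; ring.
apply: zcP => // n; apply: (addIr (zc z idx1 n)).
by rewrite h3 h1.
Qed.

Lemma component_conjugation : exists f : Z -> Z,
  [/\ {morph f : x y / x + y},
      forall (a : R[i]) x, f (a *: x) = (a^*)%C *: f x,
      involutive f &
      forall x, nrm (f x) <= 20 * omega k e ^+ 24 * nrm x].
Proof.
have [f fP] := choice (fun z : Z => component_conj_exists eta0 edecr z).
have f3 x n : zc (f x) idx3 n = ((zc x idx3 n)^*)%C by have [] := fP x.
have f4 x n : zc (f x) idx4 n = ((zc x idx4 n)^*)%C by have [] := fP x.
exists f; split.
- move=> x y; apply: zcP34 => n; rewrite zcD.
    by rewrite !f3 zcD rmorphD.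
  by rewrite !f4 zcD rmorphD.
- move=> a x; apply: zcP34 => n; rewrite zcZ.
    by rewrite !f3 zcZ rmorphM.
  by rewrite !f4 zcZ rmorphM.
- move=> x; apply: zcP34 => n.
    by rewrite !f3 conjcK.
  by rewrite !f4 conjcK.
- by move=> x; have [] := fP x.
Qed.

End component_conjugation.

(** * When two sign structures are isomorphic *)

Section structures.
Context {R : realType} (p : exponent R) (q : nat -> nat -> R)
  (P : nat -> nat -> nat -> exponent R).
Hypothesis adm : admissible p q (fun k m j => P k m j).
Local Notation X := (X_complex p P).
Local Notation e k m := (P k.+1 m.+1).

Lemma adm_decr k m j : (0 < j < 5)%N -> (e k m j.+1 : R) < (e k m j : R).
Proof. exact: (P_decr adm). Qed.

Lemma adm_eta_gt0 k m : 0 < eta_km (e k m).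
Proof.
rewrite /eta_km /eta subr_gt0 ltf_pV2 ?posrE ?exponent_gt0//.
exact: adm_decr.
Qed.

Lemma adm_eta_le1 k m : eta_km (e k m) <= 1.
Proof.
rewrite /eta_km /eta lerBlDr; apply: le_trans (_ : 1 <= _).
  by rewrite invf_le1 ?exponent_gt0// exponent_ge1.
by rewrite lerDl invr_ge0 ltW// exponent_gt0.
Qed.

(** Take the identity on components where the signs agree and the conjugation where they differ. The
    latter occurs only for [k < n], where the norms are bounded uniformly in [m], so the pieces glue
    to a bounded involution of [X]. *)
Lemma sign_operator_iso (al be : nat -> nat -> bool) (n : nat) :
  (forall k m, (n <= k)%N -> al k m = be k m) ->
  complex_structure_iso (realification X) (sign_operator p P al)
    (sign_operator p P be).
Proof.
move=> albe.
(* The component of index [k] has first parameter [k + 1], so its [w] is at most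
   [k + 2 <= n + 1]. *)
pose c : R := 20 * n.+1%:R ^+ 24.
have c0 : 0 <= c by rewrite mulr_ge0 ?exprn_ge0.
have c1 : 1 <= c.
  by rewrite /c -[leLHS]mul1r ler_pM ?exprn_ege1 ?ler1n.
have gex k m : exists g : X_component p k.+1 (e k m) -> X_component p k.+1 (e k m),
    [/\ {morph g : x y / x + y},
      forall (a : R) x, g (a%:C%C *: x) = a%:C%C *: g x,
      involutive g,
      forall x, nrm (g x) <= c * nrm x &
      forall x, g (unit_sign (al k m) *: x) = unit_sign (be k m) *: g x].
  have [ab|ab] := eqVneq (al k m) (be k m).
    by exists id; split => // [x|x]; rewrite ?ab// ler_peMl ?nrm_ge0.
  have kn : (k < n)%N by rewrite ltnNge; apply: contra ab => /albe ->.
  have [f [fD fZ fK fC]] := @component_conjugation R p k.+1 (e k m)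
    (adm_eta_gt0 k m) (fun j h => ltW (adm_decr k m h)).
  exists f; split => //.
  - by move=> a x; rewrite fZ conjc_real.
  - move=> x; apply: le_trans (fC x) _; rewrite ler_wpM2r ?nrm_ge0//.
    rewrite /c ler_wpM2l// lerXn2r ?nnegrE//.
      by rewrite ltW// omega_gt0// adm_eta_gt0.
    apply: le_trans (omega_le _ (adm_eta_gt0 k m)) _.
    by rewrite ler_nat ltnS.
  - move=> x; rewrite fZ; congr (_ *: _); rewrite /unit_sign.
    case: (al k m) (be k m) ab => -[]//= _; rewrite /conjc/=; congr Complex.
    + by rewrite oppr0.
    + by rewrite oppr0.
    + by rewrite opprK.
have gx k m := cid (gex k m).
pose g k m := projT1 (gx k m).
have [A AE] := @component_operator R p P g c c0
  (fun k m => let: And5 h _ _ _ _ := projT2 (gx k m) in h)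
  (fun k m => let: And5 _ h _ _ _ := projT2 (gx k m) in h)
  (fun k m => let: And5 _ _ _ h _ := projT2 (gx k m) in h).
have AK x : A (A x) = x.
  apply: (@xcP _ p P) => k m; rewrite !AE.
  by have [_ _ h _ _] := projT2 (gx k m); exact: h.
exists A, A; split=> // x; apply: (@xcP _ p P) => k m.
rewrite AE !sign_operatorE AE.
have [_ _ h1 _ h2] := projT2 (gx k m).
by rewrite /g h2 h1.
Qed.

Local Notation q0 c := (q c.1.+1 c.2.+1).

Lemma q_pair_next c : q0 (pair_next c) < q0 c.
Proof.
case: c => k [|m] /=; last by have [] := q_order adm (ltn0Sn k) (ltn0Sn m).
case: k => [|k]; first exact: (q_decr adm).
by have [_] := q_order adm (ltn0Sn k) (ltn0Sn 0); rewrite add1n addn1.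
Qed.

Lemma q_pair_nth i i' : (i <= i')%N -> q0 (pair_nth i') <= q0 (pair_nth i).
Proof.
elim: i' => [|i' IH]; first by rewrite leqn0 => /eqP ->.
rewrite leq_eqVlt => /predU1P[->//|/IH]; apply: le_trans.
exact/ltW/q_pair_next.
Qed.

Lemma P_between k m : [/\ (e k m 1 : R) < q0 (k, m),
  q0 (pair_next (k, m)) < (e k m 5 : R) &
  forall j : 'I_5, (e k m 5 : R) <= (e k m j.+1 : R) <= (e k m 1 : R)].
Proof.
have [P1 P5] := P_range adm (ltn0Sn k) (ltn0Sn m); split=> //.
  by move: P5; rewrite /succ_pair; case: m {P1}.
have d1 := ltW (adm_decr k m (j := 1) isT).
have d2 := ltW (adm_decr k m (j := 2) isT).
have d3 := ltW (adm_decr k m (j := 3) isT).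
have d4 := ltW (adm_decr k m (j := 4) isT).
by elim/ord5_ind => /=; apply/andP; split; lra.
Qed.

Lemma q_gt k m : (p : R) < q0 (k, m).
Proof. by have /andP[] := q_range adm (ltn0Sn k) (ltn0Sn m). Qed.

Lemma adm_gap k m : 'C((k + m).+2, 2)%:R * eta_km (e k m) <
  (e k m 1 : R)^-1 - (q0 (k, m))^-1.
Proof.
have := P_gap adm (ltn0Sn k) (ltn0Sn m).
rewrite addSn addnS (addnC m) subn1 /= -bin2_double natrM mulfK ?pnatr_eq0//.
Qed.

Definition embed k m (z : X_component p k.+1 (e k m)) : X :=
  lp_single p (i := k) (lp_single p (i := m) z).

Lemma xc_embed k m (z : X_component p k.+1 (e k m)) : xc (embed z) k m = z.
Proof.
by rewrite /xc /embed/= dfwithin/= dfwithin.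
Qed.

Lemma xc_embed_k k m (z : X_component p k.+1 (e k m)) k' m' :
  k != k' -> xc (embed z) k' m' = 0.
Proof. by move=> kk; rewrite /xc /embed/= dfwithout. Qed.

Lemma xc_embed_m k m (z : X_component p k.+1 (e k m)) m' :
  m != m' -> xc (embed z) k m' = 0.
Proof. by move=> mm; rewrite /xc /embed/= dfwithin/= dfwithout. Qed.

Lemma embedP k m (z : X_component p k.+1 (e k m)) (x : X) :
  xc x k m = z -> (forall k' m', (k, m) != (k', m') -> xc x k' m' = 0) ->
  embed z = x.
Proof.
move=> xz x0; apply: xcP => k' m'; have [kk|kk] := eqVneq k k'; last first.
  by rewrite xc_embed_k// x0// xpair_eqE (negPf kk).
subst k'; have [mm|mm] := eqVneq m m'; first by subst m'; rewrite xc_embed.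
by rewrite xc_embed_m// x0// xpair_eqE (negPf mm) andbF.
Qed.

Lemma xc_embed0 k m (z : X_component p k.+1 (e k m)) k' m' :
  (k, m) != (k', m') -> xc (embed z) k' m' = 0.
Proof.
rewrite xpair_eqE negb_and; have [kk|kk] := eqVneq k k' => /= mm.
  by subst k'; rewrite xc_embed_m.
by rewrite xc_embed_k.
Qed.

Lemma embedD k m : {morph @embed k m : x y / x + y}.
Proof.
move=> x y; apply: embedP => [|k' m' km]; rewrite xcD ?xc_embed//.
by rewrite !xc_embed0// addr0.
Qed.

Lemma embedZ k m a z : @embed k m (a *: z) = a *: embed z.
Proof.
apply: embedP => [|k' m' km]; rewrite xcZ ?xc_embed//.
by rewrite !xc_embed0// scaler0.
Qed.

Lemma embedN k m z : @embed k m (- z) = - embed z.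
Proof. by rewrite -scaleN1r embedZ scaleN1r. Qed.

Lemma nrm_embed k m (z : X_component p k.+1 (e k m)) : nrm (embed z) = nrm z.
Proof. by rewrite /embed !nrm_lp_single. Qed.

(** Where the signs differ, the isomorphism restricted to that component falls under [core_bound]
    with a constant independent of the component. Hence [w], and with it [k], is bounded, and no row
    beyond this bound contains a difference. *)
Lemma sign_operator_iso_bound (al be : nat -> nat -> bool) :
  complex_structure_iso (realification X) (sign_operator p P al)
    (sign_operator p P be) ->
  exists C : R, forall k m, (0 < k)%N -> al k m != be k m -> k%:R <= 47 * C ^+ 2.
Proof.
move=> [A [B [AK BK AB]]].
have [cA [cA1 AC]] := bounded_operator_bound A.
have [cB [cB1 BC]] := bounded_operator_bound B.
pose C := Num.max cA cB; exists C => k m k0 ab.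
have C1 : 1 <= C by rewrite le_max cA1.
pose T (z : X_component p k.+1 (e k m)) : flat p (flat_exp P) := to_flat (A (embed z : X) : X).
pose own (j : 'I_5) : flat_index := (k, (m, j)).
have AD (x y : X) : (A (x + y : X) : X) = (A x : X) + (A y : X).
  exact: (raddfD A).
have AZ (a : R) (x : X) : (A (a%:C%C *: x : X) : X) = a%:C%C *: (A x : X).
  exact: (linearZ_LR (bop_linear A) a (x : realification X)).
have AN (x : X) : (A (- x : X) : X) = - (A x : X) by exact: (raddfN A).
have AJ (x : X) : A (sign_operator p P al x) = sign_operator p P be (A x).
  by rewrite -AB AK.
(* Opposite signs at [(k, m)] turn the intertwining relation into antilinearity of the own part; if
   the source sign is [- i], the relation is used after a change of sign of the argument. *)
have Ai (z : X_component p k.+1 (e k m)) :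
    xc (A (embed ('i%C *: z)) : X) k m = - ('i%C *: xc (A (embed z) : X) k m).
  have Jz : sign_operator p P al (embed z : X) = embed (unit_sign (al k m) *: z).
    apply/esym; apply: embedP => [|k' m' km]; rewrite sign_operatorE.
      by rewrite xc_embed.
    by rewrite xc_embed0// scaler0.
  have := AJ (embed z); rewrite Jz => /(congr1 (fun x : X => xc x k m)).
  rewrite sign_operatorE; case: (al k m) (be k m) ab => -[]//= _ h.
    by rewrite h scaleNr.
  by rewrite -h scaleNr embedN AN; exact: esym (opprK _).
have TD : {morph T : x y / x + y}.
  by move=> x y; rewrite /T embedD AD to_flatD.
have TZ (c : R) x : T (c%:C%C *: x) = c%:C%C *: T x.
  by rewrite /T embedZ AZ to_flatZ.
have TC x : nrm (T x) <= C * nrm x.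
  rewrite /T nrm_to_flat -(nrm_embed x); apply: le_trans (AC _) _.
  by rewrite ler_wpM2r ?nrm_ge0// le_max lexx.
have Tge x : nrm x <= C * nrm (T x).
  rewrite /T nrm_to_flat -(nrm_embed x) -[X in nrm X <= _](AK (embed x)).
  apply: le_trans (BC _) _.
  by rewrite ler_wpM2r ?nrm_ge0// le_max lexx orbT.
have eta0 := adm_eta_gt0 k m.
have [P1 P5 Pj] := P_between k m.
have pP (i : flat_index) : (p : R) < (flat_exp P i : R).
  case: i => k' [m' j]; have [_ h /(_ j) /andP[h' _]] := P_between k' m'.
  apply: lt_le_trans h'; apply: lt_trans h.
  by case: (pair_next (k', m')) => k'' m''; exact: q_gt.
pose n := 'C((k + m).+2, 2).
(* The five coordinates of every component that precedes [(k, m)]; their exponents are at least [q]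
   of this pair, while those of the components after it are below [q] of its successor. *)
pose early : seq flat_index := [seq ((pair_nth i).1, ((pair_nth i).2, j)) |
  i <- iota 0 (pair_rank (k, m)), j <- enum 'I_5].
(* Positivity of [k] enters here; [w >= 2] gives the required [n <= 2 ^ n <= w ^ n]. *)
have w2 : 2 <= omega k.+1 (e k m).
  apply: le_trans (omega_ge k.+1 eta0 (adm_eta_le1 k m)); by rewrite ler_nat.
have step j : (1 <= j < 5)%N ->
    (e k m j.+1 : R)^-1 - (e k m j : R)^-1 = eta_km (e k m).
  exact: (P_step adm).
have := @core_bound R p k.+1 (e k m) flat_index (flat_exp P) own eta0 step
  (fun j => ltW (pP (own j))) (le_lt_trans (exponent_ge1 p) (pP (own idx4)))
  (fun j => erefl) T C C1 TD TZ TC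
  (fun x j l => zcE _ j l) (fun x j l => congr1 (fun z => zc z j l) (Ai x))
  (q0 (k, m)) (q0 (pair_next (k, m))) n early Tge.
move=> /(_ _ _ _ _ _ _ _ _) bound.
apply: le_trans (bound _ _ _ _ _ _ _ _).
- apply: le_trans (omega_ge k.+1 eta0 (adm_eta_le1 k m)); by rewrite ler_nat.
- exact: lt_trans (exponent_gt0 p) (q_gt k m).
- exact: adm_gap.
- apply: le_trans (_ : (2 ^ n)%:R <= _); first by rewrite ler_nat ltnW// ltn_expl.
  by rewrite natrX lerXn2r ?nnegrE// (le_trans _ w2).
- rewrite size_allpairs size_iota size_enum_ord mulnC leq_mul2l/=.
  exact/ltnW/pair_rank_lt.
- move=> _ /allpairsP[[i j] [/= + _ ->]]; rewrite mem_iota add0n leq0n andTb => ik.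
  rewrite /flat_exp/=.
  have [_ h /(_ j) /andP[h' _]] := P_between (pair_nth i).1 (pair_nth i).2.
  apply: le_trans h'; apply: le_trans (ltW h).
  by have := q_pair_nth ik; rewrite pair_rankK -surjective_pairing.
- by case: (pair_next (k, m)) => k'' m''; exact/ltW/q_gt.
- exact: P5.
move=> [k' [m' j]] iE io; rewrite ltW ?pP//= /flat_exp/=.
have [h _ /(_ j) /andP[_ h']] := P_between k' m'.
apply: le_trans h' _; apply: le_trans (ltW h) _.
suff rk : (pair_rank (k, m) < pair_rank (k', m'))%N.
  have := q_pair_nth rk; rewrite pair_rankK.
  by rewrite /pair_nth/= -/(pair_nth _) pair_rankK.
rewrite ltn_neqAle leqNgt; apply/andP; split.
  apply: contra (io j) => /eqP /(congr1 pair_nth); rewrite !pair_rankK.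
  by rewrite /own => -[-> ->].
apply: contra iE => rk; apply/allpairsP; exists (pair_rank (k', m'), j).
by rewrite mem_iota add0n rk mem_enum pair_rankK.
Qed.

End structures.

(** * Borel measurability of the reduction *)

Section continuity.
Context {R : realType} (p : exponent R) (P : nat -> nat -> nat -> exponent R).
Local Notation X := (X_complex p P).
Implicit Types al be : nat -> nat -> bool.

Definition agree_upto (n : nat) al be :=
  forall k m, (k < n)%N -> (m < n)%N -> al k m = be k m.

(** Outside finitely many components [x] has norm at most [d / 2], and two unimodular signs differ
    by at most 2. *)
Lemma sign_operator_close al (x : X) (d : R) : 0 < d -> exists n : nat,
  forall be, agree_upto n al be ->
  nrm ((sign_operator p P al x : X) - (sign_operator p P be x : X)) <= d.
Proof.
move=> d0; have d20 : 0 < d / 2 by rewrite divr_gt0.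
have [r rP] := lp_tail (to_flat x) d20.
exists (\max_(i <- r) (i.1 + i.2.1).+1) => be albe.
rewrite -nrm_to_flat; set D := (_ - _).
have -> : d = 2 * (d / 2) by rewrite mulrC divfK.
apply: le_trans (ler_wpM2l _ rP); last by [].
apply: nrm_lp_dom => // -[k [m j]].
have DE : to_flat D (k, (m, j)) =
    (unit_sign (al k m) - unit_sign (be k m)) *: to_flat x (k, (m, j)).
  apply: lp_sumP => n.
  have -> : to_flat D (k, (m, j)) n = zc (xc (sign_operator p P al x) k m) j n -
    zc (xc (sign_operator p P be x) k m) j n by [].
  by rewrite !sign_operatorE !zcZ -mulrBl.
rewrite DE nrmZ lp_restrE; case: ifPn => [_|/negPn ir].
  rewrite ler_wpM2r ?nrm_ge0//.
  by rewrite (le_trans (ler_nrmB _ _))// !nrm_unit_sign.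
have km : ((k + m).+1 <= \max_(i <- r) (i.1 + i.2.1).+1)%N.
  exact: (@leq_bigmax_seq _ r xpredT (fun i => (i.1 + i.2.1).+1) _ ir isT).
rewrite albe ?subrr ?nrm0 ?mul0r ?mulr_ge0//.
  by apply: leq_trans km; rewrite ltnS leq_addr.
by apply: leq_trans km; rewrite ltnS leq_addl.
Qed.

(** Continuity from bits to the strong operator topology. Were it to fail, bits agreeing with [al]
    up to [n] would give operators outside [U] for every [n], yet converging pointwise to the one of
    [al]. *)
Lemma sign_operator_nbhs al
    (U : set (bounded_operator (realification X) (realification X))) :
  open U -> U (sign_operator p P al) ->
  exists n, forall be, agree_upto n al be -> U (sign_operator p P be).
Proof.
move=> [W Wo WU] Ual; apply: contrapT => no.
have /choice[be beP] n : exists be, agree_upto n al be /\ ~ U (sign_operator p P be).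
  apply: contrapT => nb; apply: no; exists n => be ab.
  by apply: contrapT => nU; apply: nb; exists be.
pose V : normedModType R := realification X.
pose F n : {ptws V -> V} := (sign_operator p P (be n) : V -> V).
have Fcvg : F @ \oo --> (sign_operator p P al : {ptws V -> V}).
  apply/pointwise_cvgP => x; apply/cvgrPdist_le => d d0.
  have [n nP] := sign_operator_close al x d0.
  exists n => // n' /= nn'; rewrite realification_normE -nrmE; apply: nP.
  by move=> k m kn mn; apply: (proj1 (beP n')); apply: leq_trans nn'.
have Wal : W (sign_operator p P al : V -> V).
  by move: Ual; rewrite -WU.
have [n _ /(_ n (leqnn n))] := Fcvg _ (open_nbhs_nbhs (conj Wo Wal)).
by have [_] := beP n; rewrite -WU.
Qed.

End continuity.

(** * Coding real sequences by bits *)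

Section bits.
Context {R : realType}.
Implicit Types x y : nat -> R.

(** The default only repeats the rational 0; every rational occurs at its own code. *)
Definition nth_rat (m : nat) : rat := odflt 0 (unpickle m).

Definition real_bits x (k m : nat) : bool := x k < ratr (nth_rat m).

Lemma real_bits_inj x y k :
  (forall m, real_bits x k m = real_bits y k m) -> x k = y k.
Proof.
move=> xy; apply/eqP; rewrite eq_le !leNgt; apply/andP; split; apply/negP => lt.
  have [r /[!in_itv]/= /andP[yr rx]] := rat_in_itvoo lt.
  have := xy (pickle r); rewrite /real_bits /nth_rat pickleK/=.
  by rewrite yr ltNge (ltW rx).
have [r /[!in_itv]/= /andP[xr ry]] := rat_in_itvoo lt.
have := xy (pickle r); rewrite /real_bits /nth_rat pickleK/=.
by rewrite xr ltNge (ltW ry).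
Qed.

(** The pattern is a finite list of lists so that all boxes together form a countable family. *)
Definition bits_box (n : nat) (s : seq (seq bool)) :
    set (borel {ptws nat -> R}) :=
  [set x | forall k m, (k < n)%N -> (m < n)%N ->
     real_bits x k m = nth false (nth [::] s k) m].

Lemma measurable_real_bits k m b :
  measurable [set x : borel {ptws nat -> R} | real_bits x k m = b].
Proof.
have mo : measurable [set x : borel {ptws nat -> R} | real_bits x k m].
  apply: sub_sigma_algebra.
  apply: (@open_comp {ptws nat -> R} R (fun x => x k)
    [set y | y < ratr (nth_rat m)]); last exact: open_lt.
  by move=> x _; exact: (@proj_continuous nat (fun=> R) k).
case: b => //.
rewrite (_ : [set x | _] = ~` [set x : borel {ptws nat -> R} | real_bits x k m]).
  exact: measurableC.
by apply/seteqP; split => x /=; [move=> ->|move=> /negP/negbTE].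
Qed.

Lemma measurable_bits_box n s : measurable (bits_box n s).
Proof.
rewrite (_ : bits_box n s = \bigcap_k \bigcap_m
  (if (k < n)%N && (m < n)%N then [set x : borel {ptws nat -> R} |
     real_bits x k m = nth false (nth [::] s k) m] else setT)).
  apply: bigcapT_measurable => k; apply: bigcapT_measurable => m.
  by case: ifP => _; [exact: measurable_real_bits|exact: measurableT].
apply/seteqP; split => x /= xb.
  by move=> k _ m _; case: ifPn => // /andP[kn mn]; exact: xb.
by move=> k m kn mn; have := xb k I m I; rewrite kn mn.
Qed.

Lemma bits_box_self n x : bits_box n
  (mkseq (fun k => mkseq (fun m => real_bits x k m) n) n) x.
Proof. by move=> k m kn mn; rewrite !nth_mkseq. Qed.

End bits.

Theorem theorem3p1 (R : realType) (p : exponent R) (q : nat -> nat -> R)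
    (P : nat -> nat -> nat -> exponent R) :
  p < 2 :> R ->
  admissible p q (fun k m j => P k m j) ->
  let X : normedModType R := realification (X_complex p P) in
  Borel_reducible
    [set: borel {ptws nat -> R}] (@E1 R)
    (complex_structure X) (complex_structure_iso X).
Proof.
move=> _ adm X; pose f (x : borel {ptws nat -> R}) : borel (bounded_operator X X) :=
  sign_operator p P (real_bits x).
exists f; split.
- apply: (@measurability _ _ _ _ _ f open) => // _ [U Uo <-]; rewrite setTI.
  (* The bits are not continuous in [x], so the preimage of an open set need not be open. It is,
     however, the union of the countably many Borel boxes that it contains. *)
  pose box i : set (borel {ptws nat -> R}) :=
    if unpickle i is Some (n, s) then bits_box n s else set0.
  rewrite (_ : f @^-1` U = \bigcup_(i in [set i | box i `<=` f @^-1` U]) box i).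
    apply: bigcup_measurable => i _; rewrite /box.
    by case: unpickle => [[n s]|]; [exact: measurable_bits_box|exact: measurable0].
  apply/seteqP; split => [x Ux|x [i iU /iU]//].
  have [n nP] := sign_operator_nbhs Uo Ux.
  pose s := mkseq (fun k => mkseq (fun m => real_bits x k m) n) n.
  have bE : box (pickle (n, s)) = bits_box n s by rewrite /box pickleK.
  exists (pickle (n, s)); rewrite /= bE; last exact: bits_box_self.
  move=> y yb; apply: nP => k m kn mn.
  rewrite (yb k m kn mn); exact: bits_box_self.
- by move=> x _; exact: sign_operator_structure.
- move=> x y _ _; split=> [[n xy]|/(sign_operator_iso_bound adm)[C CP]].
    by apply: (sign_operator_iso adm (n := n)) => k m nk; rewrite /real_bits xy.
  (* From this index on [k] is positive and exceeds [47 C ^ 2], so a differing bit in row [k] would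
     contradict the bound. *)
  exists (Num.truncn (47 * C ^+ 2)).+1 => k Ck; apply: real_bits_inj => m.
  apply/eqP/negPn/negP => xy.
  have := CP k m (leq_ltn_trans (leq0n _) Ck) xy.
  apply/negP; rewrite -ltNge; apply: lt_le_trans (truncnS_gt _) _.
  by rewrite ler_nat.
Qed.
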